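(* Let $K$ be a totally real field of degree $2^n$ with $n\ge 1$. Suppose $2$ is totally ramified in $K$ and the narrow class number $h_K^+$ is odd. Then $K=\mathbb{Q}(\zeta_{2^{n+2}})^+$.
   Context: $\mathbb{Q}(\zeta_{m})^+$ denotes the maximal totally real subfield of the cyclotomic field $\mathbb{Q}(\zeta_m)$; equality of fields is up to isomorphism. *)

(* Defs.v *)
From HB Require Import structures.
From mathcomp Require Import all_boot all_order all_fingroup all_algebra.
From mathcomp Require Import all_solvable all_field.
From mathcomp Require Import finmap boolp classical_sets cardinality.

Set Implicit Arguments.
Unset Strict Implicit.
Unset Printing Implicit Defensive.

Import Order.TTheory GRing.Theory Num.Theory.

Local Open Scope classical_set_scope.
Local Open Scope ring_scope.

(* A number field is a [fieldExtType rat].  Its complex embeddings take values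
   in the algebraic numbers, hence are the ring morphisms to [algC]; on [algC],
   [0 < z] means that z is real and positive. *)

Definition real_embedding (K : fieldExtType rat) (s : {rmorphism K -> algC}) :=
  forall x : K, s x \is Num.real.

Definition totally_real (K : fieldExtType rat) :=
  forall s : {rmorphism K -> algC}, real_embedding s.

Definition totally_positive (K : fieldExtType rat) (x : K) :=
  x != 0 /\ forall s : {rmorphism K -> algC}, real_embedding s -> 0 < s x.

Definition ring_of_integers (K : fieldExtType rat) : set K :=
  [set x | integralOver (intr : int -> K) x].

Definition integer_submodule (K : fieldExtType rat) (I : set K) :=
  [/\ I 0, forall x y, I x -> I y -> I (x + y)
    & forall a x, ring_of_integers a -> I x -> I (a * x)].

Definition integral_ideal (K : fieldExtType rat) (I : set K) :=
  integer_submodule I /\ I `<=` @ring_of_integers K.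

Definition prime_ideal (K : fieldExtType rat) (P : set K) :=
  [/\ integral_ideal P, ~ P 1
    & forall x y, ring_of_integers x -> ring_of_integers y ->
        P (x * y) -> P x \/ P y].

Definition ideal_mul (K : fieldExtType rat) (I J : set K) : set K :=
  [set x | exists (m : nat) (a b : 'I_m -> K),
     (forall i, I (a i) /\ J (b i)) /\ x = \sum_(i < m) a i * b i].

Definition ideal_exp (K : fieldExtType rat) (I : set K) (k : nat) : set K :=
  iter k (ideal_mul I) (@ring_of_integers K).

Definition scale_ideal (K : fieldExtType rat) (a : K) (I : set K) : set K :=
  [set a * x | x in I].

Definition totally_ramified (K : fieldExtType rat) (p : nat) :=
  exists2 P : set K, prime_ideal P
    & scale_ideal p%:R (@ring_of_integers K) = ideal_exp P (\dim {: K}).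

Definition fractional_ideal (K : fieldExtType rat) (I : set K) :=
  [/\ integer_submodule I, exists2 x, I x & x != 0
    & exists2 d, ring_of_integers d /\ d != 0
        & scale_ideal d I `<=` @ring_of_integers K].

Definition narrow_class (K : fieldExtType rat) (I : set K) : set (set K) :=
  [set J | exists2 a, totally_positive a & J = scale_ideal a I].

(* The cosets, in the group of fractional ideals, of the subgroup of principal
   ideals with a totally positive generator. *)
Definition narrow_class_group (K : fieldExtType rat) : set (set (set K)) :=
  [set narrow_class I | I in @fractional_ideal K].
Arguments narrow_class_group K : clear implicits.

(* [fset_set] is empty on infinite sets: were the narrow class group infinite,
   this number would be 0. *)
Definition narrow_class_number (K : fieldExtType rat) : nat :=
  #|` fset_set (narrow_class_group K) |.

(* For m > 0, the subfield of the complex numbers generated by a primitive m-th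
   root of unity, as an abstract number field (see [cyclotomic_fieldP]). *)
Definition cyclotomic_field (m : nat) : fieldExtType rat :=
  projT1 (num_field_exists [:: sval (C_prim_root_exists (ltn0Sn m.-1))]).

Lemma cyclotomic_fieldP (m : nat) : (0 < m)%N ->
  exists2 z : cyclotomic_field m,
    m.-primitive_root z & <<1; z>>%VS = fullv.
Proof.
move=> m_gt0; rewrite /cyclotomic_field.
case: (C_prim_root_exists _) => w /= prim_w.
case: (num_field_exists _) => L [f] [[|z [|? ?]] //= [fz] gen].
exists z; last by rewrite -gen adjoin_seq1.
by move: prim_w; rewrite -fz prednK // fmorph_primitive_root.
Qed.

Definition maximal_totally_real (L : fieldExtType rat) (E : {subfield L}) :=
  totally_real (subvs_of E) /\
  forall F : {subfield L}, totally_real (subvs_of F) -> (F <= E)%VS.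

Definition field_isomorphic (K L : fieldType) :=
  exists f : {rmorphism K -> L}, bijective f.

(* Main.v *)
Require Import Defs.
From HB Require Import structures.
From mathcomp Require Import all_boot all_order all_fingroup all_algebra.
From mathcomp Require Import all_solvable all_field.
From mathcomp Require Import finmap boolp classical_sets cardinality.

(** Multiplication by an ideal [Q] with [Q^(2^j) = (b)], [b] totally positive, is a
    permutation of 2-power order of the narrow classes.  As there is an odd number of
    them, some class is fixed, and this forces [Q] to have a totally positive generator.
    For [Q] the prime above 2 this gives [2 = u c^(2^n)] with [c] totally positive and
    [u] a unit; for [Q] principal it shows that units take all signatures.  Since the
    unit rank is at most [[K : Q] - 1], every totally positive unit is then a square.
    Consequently [2 = 2 + x_0] with [x_0 = 0] is a square [x_1^2] in [K], then
    [2 + x_1] is a square [x_2^2], and so on up to [x_n], because [2 + x_k] is totally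
    positive and equal to a unit times [c^(2^(n-k))].  Finally [x_n] has the same minimal
    polynomial, of degree [2^n], as [z + z^-1] for [z] a primitive [2^(n+2)]-th root of
    unity. *)

Set Implicit Arguments.
Unset Strict Implicit.
Unset Printing Implicit Defensive.

Import Order.TTheory GRing.Theory Num.Theory.

Local Open Scope classical_set_scope.
Local Open Scope ring_scope.

(** * Embeddings and traces *)

(** Every element of [K] is [q(t)] for some rational [q], and [q(t)] determines [q(r)] because [p]
    divides any polynomial vanishing at [t]. Evaluation at [r] is therefore a well-defined
    morphism. *)
Lemma exists_rmorphism_root (K : fieldExtType rat) (F : fieldType)
    (iota : {rmorphism rat -> F}) (t : K) (p : {poly rat}) (r : F) :
  <<1; t>>%VS = fullv -> minPoly 1 t = map_poly (in_alg K) p ->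
  root (map_poly iota p) r -> exists s : {rmorphism K -> F}, s t = r.
Proof.
move=> gen_t minp pr.
have /choice [q qP] (x : K) : exists q, x = (map_poly (in_alg K) q).[t].
  by apply/Fadjoin1_polyP; rewrite gen_t memvf.
have val_eq (q1 q2 : {poly rat}) :
    (map_poly (in_alg K) q1).[t] = (map_poly (in_alg K) q2).[t] ->
    (map_poly iota q1).[r] = (map_poly iota q2).[r].
  move/eqP; rewrite -subr_eq0 -hornerN -hornerD -rmorphB => q12.
  have : p %| q1 - q2.
    rewrite -(dvdp_map (in_alg K)) -minp minPoly_dvdp //.
    exact: alg_polyOver.
  rewrite -(dvdp_map iota) => /dvdpP[m defq].
  apply/eqP; rewrite -subr_eq0 -hornerN -hornerD -rmorphB /= defq.
  by rewrite hornerM (rootP pr) mulr0.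
pose f x := (map_poly iota (q x)).[r].
have fE q1 : f (map_poly (in_alg K) q1).[t] = (map_poly iota q1).[r].
  exact/val_eq/esym/qP.
have fB : zmod_morphism f.
  move=> x y; rewrite {1}(qP x) {1}(qP y) -hornerN -hornerD -rmorphB fE.
  by rewrite rmorphB hornerD hornerN.
have fM : monoid_morphism f.
  split=> [|x y].
    by have := fE 1; rewrite !rmorph1 !hornerC.
  by rewrite {1}(qP x) {1}(qP y) -hornerM -rmorphM fE rmorphM hornerM.
pose fA := GRing.isZmodMorphism.Build _ _ f fB.
pose fR := GRing.isMonoidMorphism.Build _ _ f fM.
pose s : {rmorphism K -> F} := HB.pack f fA fR.
exists s; rewrite /= -[t in LHS](hornerX t) -(map_polyX (in_alg K)).
by rewrite [LHS]fE map_polyX hornerX.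
Qed.

(** A primitive element becomes integral once multiplied by a common denominator [a] of its minimal
    polynomial. *)
Lemma number_field_generator (K : fieldExtType rat) :
  exists2 t : K, ring_of_integers t & <<1; t>>%VS = fullv.
Proof.
have sepK : separable 1 {:K}.
  apply/separableP => x _; apply: pcharf0_separable => p.
  by rewrite pchar_lalg pchar_num.
have := eq_adjoin_separable_generator sepK (sub1v _).
set t := separable_generator _ _ => gen_t.
have /polyOver1P[p minp] := minPolyOver 1 t.
have [q [a a_neq0 defp]] := rat_poly_scale p.
have aK_neq0 : a%:~R != 0 :> K.
  by rewrite -(rmorph_int (in_alg K)) fmorph_eq0 intr_eq0.
exists (a%:~R * t); last first.
  apply/eqP; rewrite eqEsubv subvf gen_t sub_adjoin1v /=.
  rewrite -[X in X \in _](mulKf aK_neq0) rpredM ?memv_adjoin //.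
  by rewrite rpredV rpred_int.
set P := minPoly 1 t in minp; set d := adjoin_degree 1 t.
have szP : size P = d.+1 by rewrite size_minPoly.
have monP : P`_d = 1 by have /monicP := monic_minPoly 1 t; rewrite /lead_coef -/P szP.
have aP i : a%:~R * P`_i = (q`_i)%:~R.
  rewrite minp defp coef_map coefZ coef_map /= -(rmorph_int (in_alg K)) -rmorphM /=.
  by rewrite mulVKf ?intr_eq0 // -(rmorph_int (in_alg K)).
(* This is [a^d P(X/a)]: monic, with root [a t], and each lower coefficient has a factor [a] that
   clears the denominator of [P]. *)
pose f : {poly K} := \poly_(i < d.+1) (P`_i * a%:~R ^+ (d - i)).
have cf i : f`_i = if (i < d.+1)%N then P`_i * a%:~R ^+ (d - i) else 0.
  exact: coef_poly.
have fd : f`_d = 1 by rewrite cf ltnSn subnn mulr1.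
have szf : size f = d.+1.
  apply/eqP; rewrite eqn_leq size_poly ltnNge.
  apply/negP => /(nth_default 0) f0; move: fd; rewrite f0 => /esym/eqP.
  by rewrite oner_eq0.
apply: (@integral_root_monic _ _ intr _ f).
- by apply/monicP; rewrite /lead_coef szf.
- rewrite rootE horner_poly; have := minPolyxx 1 t.
  rewrite -/P horner_coef szP => Pt0.
  apply/eqP; transitivity (a%:~R ^+ d * \sum_(i < d.+1) P`_i * t ^+ i).
    rewrite mulr_sumr; apply: eq_bigr => i _.
    have -> : a%:~R ^+ d = a%:~R ^+ (d - i) * a%:~R ^+ i :> K.
      by rewrite -exprD subnK // -ltnS.
    by rewrite exprMn [P`_i * _]mulrC -!mulrA; congr (_ * _); rewrite mulrCA.
  by rewrite Pt0 mulr0.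
- apply/integral_poly => i; rewrite cf; case: ifP => [|_]; last exact: integral0.
  rewrite ltnS leq_eqVlt => /predU1P[->|lt_id].
    by rewrite subnn mulr1 monP; exact: integral1.
  rewrite -[(d - i)%N]prednK ?subn_gt0 // exprS mulrA [_ * a%:~R]mulrC aP.
  by rewrite -rmorphXn -rmorphM; exact: integral_id.
Qed.

(** Distinct values at a single generator [t] make the matrix of conjugates of the powers of [t] an
    invertible Vandermonde matrix. *)
Definition conjugate_system (K : fieldExtType rat) (t : K)
    (s : 'I_(\dim {:K}) -> {rmorphism K -> algC}) :=
  [/\ ring_of_integers t, <<1; t>>%VS = fullv & injective (fun i => s i t)].

(** The minimal polynomial of a generator is separable in characteristic 0, so it has [[K : Q]]
    distinct roots in [algC], each giving an embedding. *)
Lemma number_field_embeddings (K : fieldExtType rat) :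
  exists (t : K) (s : 'I_(\dim {:K}) -> {rmorphism K -> algC}),
    conjugate_system t s.
Proof.
have [t Ot gen_t] := number_field_generator K.
have /polyOver1P[p minp] := minPolyOver 1 t.
have sep_t : separable_poly (minPoly 1 t).
  by apply: pcharf0_separable => q; rewrite pchar_lalg pchar_num.
have szp : size p = (\dim {:K}).+1.
  have := size_minPoly 1 t; rewrite minp size_map_poly => ->.
  by rewrite -gen_t dim_Fadjoin dimv1 muln1.
have [rs defp] := closed_field_poly_normal (map_poly ratr p : {poly algC}).
have lp : lead_coef (map_poly ratr p : {poly algC}) != 0.
  by rewrite lead_coef_map fmorph_eq0 lead_coef_eq0 -size_poly_gt0 szp.
have szrs : size rs = \dim {:K}.
  apply/eqP; rewrite -eqSS -(size_prod_XsubC _ id) -(size_scale _ lp) -defp.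
  by rewrite size_map_poly szp.
have uniq_rs : uniq rs.
  rewrite -separable_prod_XsubC; move: sep_t; rewrite minp separable_map.
  rewrite -(separable_map (ratr : {rmorphism rat -> algC})) defp.
  by apply: dvdp_separable; rewrite dvdpZr.
have /choice[s sP] (i : 'I_(\dim {:K})) :
    exists s : {rmorphism K -> algC}, s t = rs`_i.
  apply: (exists_rmorphism_root gen_t minp (iota := ratr)).
  by rewrite defp rootZ // root_prod_XsubC mem_nth // szrs.
exists t, s; split=> // i j; rewrite !sP => /eqP.
by rewrite nth_uniq ?szrs // => /eqP/val_inj.
Qed.

Lemma integral_Aint (K : fieldExtType rat) (s : {rmorphism K -> algC}) (x : K) :
  ring_of_integers x -> s x \in Aint.
Proof.
case=> p mon_p px0; apply: (@root_monic_Aint (map_poly intr p)).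
- have -> : map_poly intr p = map_poly s (map_poly intr p).
    by rewrite -map_poly_comp; apply: eq_map_poly => a /=; rewrite rmorph_int.
  by rewrite fmorph_root.
- exact: monic_map.
- by apply/polyOverP => i; rewrite coef_map /= rpred_int.
Qed.

Section Conjugates.

Variables (K : fieldExtType rat) (t : K).
Local Notation d := (\dim {:K}).
Variable s : 'I_d -> {rmorphism K -> algC}.
Hypothesis conj_s : conjugate_system t s.

Let E : 'M[algC]_d := Vandermonde d (\row_i s i t).

Let E_unit : E \in unitmx.
Proof.
case: conj_s => _ _ inj_s; rewrite unitmxE det_Vandermonde unitfE.
apply/prodf_neq0 => i _; apply/prodf_neq0 => j lt_ij.
rewrite !mxE subr_eq0; apply/eqP => /inj_s eq_ij.
by rewrite eq_ij ltnn in lt_ij.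
Qed.

Lemma generator_coords (y : K) :
  exists c : 'I_d -> rat, y = \sum_(k < d) c k *: t ^+ k.
Proof.
case: conj_s => _ gen_t _.
have y_in : y \in <<1; t>>%VS by rewrite gen_t memvf.
have deg_t : adjoin_degree 1 t = d by rewrite -gen_t dim_Fadjoin dimv1 muln1.
have /polyOver1P[q defq] := Fadjoin_polyOver 1 t y.
exists (fun k => q`_k); rewrite -{1}(Fadjoin_poly_eq y_in).
rewrite (horner_coef_wide (n := d)); last by rewrite -deg_t size_Fadjoin_poly.
by apply: eq_bigr => k _; rewrite defq coef_map /= mulr_algl.
Qed.

(* The matrix of multiplication by [x] in the basis of powers of [t] is
   diagonalised by the Vandermonde matrix of the conjugates of [t]. *)
Let mul_matrix (x : K) :
  exists M : 'M[rat]_d, map_mx ratr M *m E = E *m diag_mx (\row_i s i x).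
Proof.
have /choice[c cP] (j : 'I_d) := generator_coords (x * t ^+ j).
exists (\matrix_(j, k) c j k); apply/matrixP => j i.
rewrite mul_mx_diag !mxE.
transitivity (s i (x * t ^+ j)); last by rewrite rmorphM rmorphXn mulrC.
rewrite cP rmorph_sum; apply: eq_bigr => k _.
by rewrite !mxE rmorphZ_num rmorphXn.
Qed.

(** The conjugates are the diagonal of a matrix similar to a rational one, whose trace is their sum
    and whose determinant is their product. *)
Lemma sum_conjugates_rat (x : K) : \sum_i s i x \in Crat.
Proof.
have [M eqM] := mul_matrix x.
suff -> : \sum_i s i x = ratr (\tr M) by exact: Crat_rat.
rewrite -trace_map_mx -[map_mx ratr M](mulmxK E_unit) eqM.
rewrite mxtrace_mulC mulKmx // mxtrace_diag.
by apply: eq_bigr => i _; rewrite mxE.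
Qed.

Lemma prod_conjugates_rat (x : K) : \prod_i s i x \in Crat.
Proof.
have [M eqM] := mul_matrix x.
suff -> : \prod_i s i x = ratr (\det M) by exact: Crat_rat.
rewrite -det_map_mx; apply: (@mulIf _ (\det E)).
  by rewrite -unitfE -unitmxE.
rewrite -[RHS]det_mulmx eqM det_mulmx mulrC det_diag; congr (_ * _).
by apply: eq_bigr => i _; rewrite mxE.
Qed.

Lemma trace_int (x : K) : ring_of_integers x -> \sum_i s i x \is a Num.int.
Proof.
move=> Ox; apply: Cint_rat_Aint; first exact: sum_conjugates_rat.
by apply: rpred_sum => i _; apply: integral_Aint.
Qed.

(** The norms of [x] and [x^-1] are nonzero rational integers, hence at least 1 in absolute value,
    and they are inverse to each other. *)
Lemma norm_unit (x : K) : x != 0 -> ring_of_integers x ->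
  ring_of_integers x^-1 -> \prod_i `|s i x| = 1.
Proof.
move=> x_neq0 Ox OVx.
have nint y : ring_of_integers y -> \prod_i s i y \is a Num.int.
  move=> Oy; apply: Cint_rat_Aint; first exact: prod_conjugates_rat.
  by apply: rpred_prod => i _; apply: integral_Aint.
have nneq0 y : y != 0 -> \prod_i s i y != 0.
  by move=> y0; apply/prodf_neq0 => i _; rewrite fmorph_eq0.
have ge1 y : y != 0 -> ring_of_integers y -> 1 <= \prod_i `|s i y|.
  move=> y0 Oy; rewrite -normr_prod.
  by apply: norm_intr_ge1; [exact: nint | exact: nneq0].
apply/eqP; rewrite eq_le ge1 // andbT.
have := ge1 _ (invr_neq0 x_neq0) OVx.
have -> : \prod_i `|s i x^-1| = (\prod_i `|s i x|)^-1.
  by rewrite -prodfV; apply: eq_bigr => i _; rewrite fmorphV normfV.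
rewrite invf_ge1 //.
by rewrite prodr_gt0 // => i _; rewrite normr_gt0 fmorph_eq0.
Qed.

(** The vanishing traces say that the row of conjugates of [x] is killed by an invertible
    Vandermonde matrix. *)
Lemma trace_form_nondegenerate (x : K) :
  (forall k : 'I_d, \sum_i s i (x * t ^+ k) = 0) -> x = 0.
Proof.
move=> tr0; have : (\row_i s i x) *m E^T = 0.
  apply/rowP => k; rewrite !mxE -[RHS](tr0 k).
  by apply: eq_bigr => i _; rewrite !mxE rmorphM rmorphXn.
move/(congr1 (mulmx^~ (invmx E^T))); rewrite mulmxK ?unitmx_tr // mul0mx.
move/rowP=> s0; apply/eqP; rewrite -(fmorph_eq0 (s (Ordinal (adim_gt0 {:K}%AS)))).
by have := s0 (Ordinal (adim_gt0 {:K}%AS)); rewrite !mxE => ->.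
Qed.

End Conjugates.

(** * Finite generation of fractional ideals and their multipliers *)

(** Induction on [d]: the kernel of the last functional in [I] is finitely generated, and unless it
    is all of [I], adding an element whose value is nonzero and least in absolute value generates
    [I], by Euclidean division of the values. *)
Lemma int_functionals_fg (V : zmodType) (d : nat) (T : nat -> {additive V -> algC})
    (I : V -> Prop) :
  I 0 -> (forall x y, I x -> I y -> I (x - y)) ->
  (forall k x, I x -> T k x \is a Num.int) ->
  (forall x, I x -> (forall k, (k < d)%N -> T k x = 0) -> x = 0) ->
  exists m (g : 'I_m -> V), (forall i, I (g i)) /\
    forall x, I x -> exists c : 'I_m -> int, x = \sum_i g i *~ c i.
Proof.
elim: d I => [|d IHd] I I0 IB Iint Iinj.
  exists 0%N, (fun _ => 0); split=> [[]//|x Ix]; exists (fun _ => 0).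
  by rewrite big_ord0; apply: Iinj.
pose J x := I x /\ T d x = 0.
have [m [g [Jg gP]]] : exists m (g : 'I_m -> V), (forall i, J (g i)) /\
    forall x, J x -> exists c : 'I_m -> int, x = \sum_i g i *~ c i.
  apply: IHd => //.
  - by split=> //; rewrite raddf0.
  - by move=> x y [Ix Tx] [Iy Ty]; split; [exact: IB | rewrite raddfB Tx Ty subr0].
  - by move=> k x [Ix _]; exact: Iint.
  - move=> x [Ix Tx] kerx; apply: Iinj => // k; rewrite ltnS leq_eqVlt.
    by case/predU1P=> [->|/kerx].
have [Td0|/existsNP[x0 /not_implyP[Ix0 Tx0]]] := pselect (forall x, I x -> T d x = 0).
  by exists m, g; split=> [i|x Ix]; [case: (Jg i) | apply: gP; split; auto].
have IMn x n : I x -> I (x *+ n).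
  elim: n => [|n IHn] Ix; first by rewrite mulr0n.
  have -> : x *+ n.+1 = x - (0 - x *+ n) by rewrite sub0r opprK mulrS.
  by apply: (IB) => //; apply: (IB) => //; exact: IHn.
have IMz x (z : int) : I x -> I (x *~ z).
  case: z => n Ix; rewrite -?pmulrn ?NegzE; first exact: IMn.
  by rewrite mulrNz -[- _]add0r; apply: IB => //; rewrite -pmulrn; exact: IMn.
pose Q n := (0 < n)%N && `[<exists x (z : int), [/\ I x, T d x = z%:~R & `|z|%N = n]>].
have exQ : exists n, Q n.
  have /intrP[z Tz] := Iint d x0 Ix0; exists `|z|%N; apply/andP; split.
    by rewrite absz_gt0; apply/eqP => z0; apply: Tx0; rewrite Tz z0.
  by apply/asboolP; exists x0, z.
case: (ex_minnP exQ) => n /andP[n_gt0 /asboolP[y [z [Iy Ty zn]]]] minn.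
exists m.+1, (fun i => oapp g y (unlift ord0 i)); split=> [i|x Ix].
  by case: unliftP => [j|] _ //=; case: (Jg j).
have /intrP[w Tw] := Iint d x Ix.
have z_neq0 : z != 0 by rewrite -absz_gt0 zn.
have Tr : T d (x - y *~ (w %/ z)%Z) = ((w %% z)%Z)%:~R.
  by rewrite raddfB raddfMz Ty Tw -mulrzA -mulrzBr mulrC.
have Ir : I (x - y *~ (w %/ z)%Z) by apply: IB => //; exact: IMz.
have r0 : (w %% z)%Z = 0.
  apply/eqP/negPn/negP; rewrite -absz_gt0 => r_gt0.
  have : (n <= `|(w %% z)%Z|)%N.
    apply: minn; rewrite /Q r_gt0 /=; apply/asboolP.
    by exists (x - y *~ (w %/ z)%Z), (w %% z)%Z.
  apply/negP; rewrite -ltnNge -zn -ltz_nat !abszE ger0_norm ?modz_ge0 //.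
  exact: ltz_mod.
have [c cP] : exists c : 'I_m -> int, x - y *~ (w %/ z)%Z = \sum_i g i *~ c i.
  by apply: gP; split=> //; rewrite Tr r0.
exists (fun i => oapp c (w %/ z)%Z (unlift ord0 i)).
rewrite big_ord_recl unlift_none /=.
rewrite -[LHS](subrK (y *~ (w %/ z)%Z)) cP addrC; congr (_ + _).
by apply: eq_bigr => i _; rewrite liftK.
Qed.

(** The determinant trick: [I] is finitely generated over the rational integers, so multiplication
    by [x] acts on generators through an integer matrix, of which [x] is an eigenvalue. *)
Lemma fractional_multiplier_integral (K : fieldExtType rat) (I : set K) (x : K) :
  fractional_ideal I -> (forall y, I y -> I (x * y)) -> ring_of_integers x.
Proof.
move=> [[I0 ID IO] [y0 Iy0 y0_neq0] [a [Oa a_neq0] aI]] xI.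
have [t [s conj_s]] := number_field_embeddings K.
have [Ot _ _] := conj_s.
(* The factor [a] moves [I] into the ring of integers, where the traces against powers of [t] are
   rational integers. *)
pose T k y := \sum_i s i (a * y * t ^+ k).
have TB k : zmod_morphism (T k).
  move=> y z; rewrite /T -sumrB; apply: eq_bigr => i _.
  by rewrite -rmorphB mulrBr mulrBl.
pose Ta k : {additive K -> algC} :=
  HB.pack (T k) (GRing.isZmodMorphism.Build _ _ (T k) (TB k)).
have OX k : ring_of_integers (t ^+ k).
  by elim: k => [|k IHk]; [exact: integral1 | rewrite exprS; exact: integral_mul].
have [||||m [g [Ig gP]]] := @int_functionals_fg K (\dim {:K}) Ta I.
- exact: I0.
- move=> y z Iy Iz; apply: ID => //; rewrite -mulN1r; apply: IO => //.
  exact/integral_opp/integral1.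
- move=> k y Iy; apply: (trace_int conj_s); apply: integral_mul; last exact: OX.
  by apply: aI; exists y.
- move=> y Iy ker_y; apply/eqP; have := mulf_eq0 a y; rewrite (negPf a_neq0) /= => <-.
  apply/eqP/(trace_form_nondegenerate conj_s) => k.
  exact: (ker_y k (ltn_ord k)).
have /choice[c cP] i := gP _ (xI _ (Ig i)).
pose C : 'M[int]_m := \matrix_(j, i) c i j.
exists (char_poly C); first exact: char_poly_monic.
rewrite map_char_poly -eigenvalue_root_char; apply/eigenvalueP.
exists (\row_j g j).
  apply/rowP => i; rewrite !mxE cP; apply: eq_bigr => j _.
  by rewrite !mxE mulrzr.
apply: contra_neq y0_neq0 => /rowP g0; have [b ->] := gP _ Iy0.
by apply: big1 => i _; have := g0 i; rewrite !mxE => ->; rewrite mul0rz.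
Qed.

(** * Ideals and narrow classes *)

(** The group generated by [f] is a 2-group, so the number of fixed points has the parity of
    [#|T|]. *)
Lemma odd_card_fixpoint (T : finType) (f : T -> T) (j : nat) :
  iter (2 ^ j) f =1 id -> odd #|T| -> exists x, f x = x.
Proof.
move=> fK oddT; have f_inj : injective f.
  apply: (@can_inj _ _ _ (iter (2 ^ j).-1 f)) => x.
  by rewrite -iterSr prednK ?expn_gt0.
pose p := perm f_inj.
have p2 : (2.-group <[p]>)%g.
  rewrite /pgroup -orderE; apply: (@pnat_dvd _ (2 ^ j)).
    rewrite order_dvdn; apply/eqP/permP => x; rewrite permX perm1.
    by rewrite (eq_iter (permE f_inj)) fK.
  by rewrite pnatX pnat_id.
have acts_p : [acts <[p]>%g, on finset.setTfor T | 'P].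
  by apply/actsP => a _ x; rewrite !inE.
have /eqP := pgroup_fix_mod p2 acts_p.
rewrite cardsT !modn2 oddT eq_sym eqb1 => odd_fix.
have /card_gt0P[x] : (0 < #|'Fix_(finset.setTfor T | 'P)(<[p]>)%g|)%N by rewrite odd_gt0.
rewrite inE => /andP[_ /afixP/(_ p (cycle_id p))] fx.
by exists x; rewrite -[RHS]fx /= /aperm permE.
Qed.

(** Oddness forces [S] to be finite, since [fset_set] of an infinite set is empty. *)
Lemma odd_fset_set_fixpoint (T : choiceType) (S : set T) (f : T -> T) (j : nat) :
  (forall x, S x -> S (f x)) -> (forall x, S x -> iter (2 ^ j) f x = x) ->
  odd #|` fset_set S| -> exists2 x, S x & f x = x.
Proof.
move=> fS fK odd_S.
have finS : finite_set S.
  by apply: contrapT => infS; move: odd_S; rewrite /fset_set; case: pselect.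
have memS x : (x \in fset_set S) <-> S x.
  by rewrite in_fset_set // inE.
pose g (x : fset_set S) : fset_set S := insubd x (f (val x)).
have gE x : val (g x) = f (val x).
  by rewrite insubdK //; apply/memS/fS/memS/valP.
have [|/=|x gx] := @odd_card_fixpoint (fset_set S) g j.
- move=> x; apply: val_inj; rewrite -[RHS]fK; last by apply/memS/valP.
  by elim: (2 ^ j)%N => //= k <-; rewrite gE.
- by rewrite -cardfE.
by exists (val x); [apply/memS/valP | rewrite -gE gx].
Qed.

Section Ideals.

Variable K : fieldExtType rat.
Local Notation O := (@ring_of_integers K).
Implicit Types (I J L Q : set K) (a b c x y : K).

Lemma ring_of_integers_submodule : integer_submodule O.
Proof.
by split; [exact: integral0 | move=> *; exact: integral_add | move=> *; exact: integral_mul].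
Qed.

Lemma ideal_mul0 I J : ideal_mul I J 0.
Proof. by exists 0%N, (fun=> 0), (fun=> 0); split=> [[]//|]; rewrite big_ord0. Qed.

Lemma ideal_mulD I J x y : ideal_mul I J x -> ideal_mul I J y -> ideal_mul I J (x + y).
Proof.
move=> [m [a [b [abP ->]]]] [n [c [e [ceP ->]]]].
exists (m + n)%N, (fun i => match fintype.split i with inl k => a k | inr k => c k end).
exists (fun i => match fintype.split i with inl k => b k | inr k => e k end).
split=> [i|]; first by case: fintype.split.
rewrite big_split_ord /=; congr (_ + _); apply: eq_bigr => i _.
  by rewrite -[lshift n i]/(unsplit (inl i)) unsplitK.
by rewrite -[rshift m i]/(unsplit (inr i)) unsplitK.
Qed.

Lemma mem_ideal_mul I J a b : I a -> J b -> ideal_mul I J (a * b).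
Proof. by move=> Ia Jb; exists 1%N, (fun=> a), (fun=> b); rewrite big_ord1. Qed.

Lemma ideal_mul_sub I J L :
  L 0 -> (forall x y, L x -> L y -> L (x + y)) ->
  (forall a b, I a -> J b -> L (a * b)) -> ideal_mul I J `<=` L.
Proof.
move=> L0 LD Lab _ [m [a [b [abP ->]]]]; apply: big_ind => // i _.
by case: (abP i); exact: Lab.
Qed.

Lemma ideal_mulA I J L : ideal_mul (ideal_mul I J) L = ideal_mul I (ideal_mul J L).
Proof.
apply/seteqP; split; apply: ideal_mul_sub; try exact: ideal_mul0; try by move=> *; exact: ideal_mulD.
- move=> a b IJa Lb; move: a IJa; apply: ideal_mul_sub => [|x y|a c Ia Jc] /=.
  + by rewrite mul0r; exact: ideal_mul0.
  + by rewrite mulrDl; exact: ideal_mulD.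
  + by rewrite -mulrA; apply: mem_ideal_mul => //; exact: mem_ideal_mul.
- move=> a b Ia; move: b; apply: ideal_mul_sub => [|x y|b c Jb Lc] /=.
  + by rewrite mulr0; exact: ideal_mul0.
  + by rewrite mulrDr; exact: ideal_mulD.
  + by rewrite mulrA; apply: mem_ideal_mul => //; exact: mem_ideal_mul.
Qed.

Lemma ideal_mulO I : integer_submodule I -> ideal_mul O I = I.
Proof.
move=> [I0 ID IO]; apply/seteqP; split=> [|x Ix].
  by apply: ideal_mul_sub => // a b; exact: IO.
by rewrite -[x]mul1r; apply: mem_ideal_mul => //; exact: integral1.
Qed.

Lemma mem_scale_ideal a I x : a != 0 -> scale_ideal a I x <-> I (a^-1 * x).
Proof.
move=> a0; split=> [[y Iy <-]|Ix]; first by rewrite mulKf.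
by exists (a^-1 * x) => //; rewrite mulVKf.
Qed.

Lemma scale_ideal_mull a I J : ideal_mul (scale_ideal a I) J = scale_ideal a (ideal_mul I J).
Proof.
apply/seteqP; split.
  apply: ideal_mul_sub => [|_ _ [x Ix <-] [y Iy <-]|_ b [x Ix <-] Jb] /=.
  - by exists 0; [exact: ideal_mul0 | rewrite mulr0].
  - by exists (x + y); [exact: ideal_mulD | rewrite mulrDr].
  - by exists (x * b); [exact: mem_ideal_mul | rewrite mulrA].
move=> _ [x IJx <-]; move: x IJx.
apply: ideal_mul_sub => [|x y|x y Ix Jy] /=.
- by rewrite mulr0; exact: ideal_mul0.
- by rewrite mulrDr; exact: ideal_mulD.
- by rewrite mulrA; apply: mem_ideal_mul => //; exists x.
Qed.

Lemma ideal_mulC I J : ideal_mul I J = ideal_mul J I.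
Proof.
apply/seteqP; split; apply: ideal_mul_sub; try exact: ideal_mul0;
  try by move=> *; exact: ideal_mulD.
  by move=> a b Ia Jb; rewrite mulrC; exact: mem_ideal_mul.
by move=> a b Ia Jb; rewrite mulrC; exact: mem_ideal_mul.
Qed.

Lemma scale_ideal_mulr a I J : ideal_mul I (scale_ideal a J) = scale_ideal a (ideal_mul I J).
Proof. by rewrite ideal_mulC scale_ideal_mull ideal_mulC. Qed.

Lemma scale_idealA a b I : scale_ideal a (scale_ideal b I) = scale_ideal (a * b) I.
Proof.
apply/seteqP; split=> [_ [_ [x Ix <-] <-]|_ [x Ix <-]].
  by exists x => //; rewrite mulrA.
by exists (b * x); [exists x | rewrite mulrA].
Qed.

Lemma scale_ideal1 I : scale_ideal 1 I = I.
Proof.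
apply/seteqP; split=> [_ [x Ix <-]|x Ix]; first by rewrite mul1r.
by exists x => //; rewrite mul1r.
Qed.

Lemma ideal_mul_exp Q I k :
  integer_submodule I -> iter k (ideal_mul Q) I = ideal_mul (ideal_exp Q k) I.
Proof.
move=> subI; elim: k => [|k IHk]; first by rewrite [RHS]ideal_mulO.
by rewrite /= IHk -ideal_mulA.
Qed.

Lemma ideal_exp_principal c k :
  ideal_exp (scale_ideal c O) k = scale_ideal (c ^+ k) O.
Proof.
elim: k => [|k IHk]; first by rewrite scale_ideal1.
rewrite /ideal_exp iterS -/(ideal_exp _ k) IHk scale_ideal_mull scale_ideal_mulr.
by rewrite (ideal_mulO ring_of_integers_submodule) scale_idealA exprS.
Qed.

Lemma integer_submodule_mul Q I : integer_submodule I -> integer_submodule (ideal_mul Q I).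
Proof.
move=> [I0 ID IO]; split; [exact: ideal_mul0 | exact: ideal_mulD |].
move=> a x Oa; move: x; apply: ideal_mul_sub => [|x y|x y Qx Iy] /=.
- by rewrite mulr0; exact: ideal_mul0.
- by rewrite mulrDr; exact: ideal_mulD.
- by rewrite mulrCA; apply: mem_ideal_mul => //; exact: IO.
Qed.

Lemma fractional_ideal_mul Q I :
  fractional_ideal Q -> fractional_ideal I -> fractional_ideal (ideal_mul Q I).
Proof.
move=> [_ [x Qx x0] [a [Oa a0] aQ]] [subI [y Iy y0] [b [Ob b0] bI]].
split; first exact: integer_submodule_mul.
  by exists (x * y); [exact: mem_ideal_mul | rewrite mulf_neq0].
exists (a * b); first by split; [exact: integral_mul | rewrite mulf_neq0].
move=> _ [z QIz <-]; move: z QIz; apply: ideal_mul_sub => [|z w|z w Qz Iw] /=.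
- by rewrite mulr0; exact: integral0.
- by rewrite mulrDr; exact: integral_add.
- by rewrite mulrACA; apply: integral_mul; [apply: aQ; exists z | apply: bI; exists w].
Qed.

Lemma fractional_integral_ideal I :
  integral_ideal I -> (exists2 x, I x & x != 0) -> fractional_ideal I.
Proof.
move=> [subI IO] nzI; split=> //; exists 1.
  by split; [exact: integral1 | exact: oner_neq0].
by rewrite scale_ideal1.
Qed.

Lemma integral_ideal_principal a : O a -> integral_ideal (scale_ideal a O).
Proof.
move=> Oa; have [O0 OD OM] := ring_of_integers_submodule.
split; last by move=> _ [x Ox <-]; exact: OM.
split=> [|_ _ [x Ox <-] [y Oy <-]|b _ Ob [x Ox <-]].
- by exists 0; [exact: O0 | rewrite mulr0].
- by exists (x + y); [exact: OD | rewrite mulrDr].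
- by exists (b * x); [exact: OM | rewrite mulrCA].
Qed.

Lemma totally_positive_mul a b :
  totally_positive a -> totally_positive b -> totally_positive (a * b).
Proof.
move=> [a0 a_gt0] [b0 b_gt0]; split=> [|s s_real]; first by rewrite mulf_neq0.
by rewrite rmorphM mulr_gt0 ?a_gt0 ?b_gt0.
Qed.

Lemma totally_positive_inv a : totally_positive a -> totally_positive a^-1.
Proof.
move=> [a0 a_gt0]; split=> [|s s_real]; first by rewrite invr_eq0.
by rewrite fmorphV invr_gt0 a_gt0.
Qed.

Lemma totally_positive_sqr a : a != 0 -> totally_positive (a ^+ 2).
Proof.
move=> a0; split=> [|s s_real]; first by rewrite expf_neq0.
by rewrite rmorphXn real_exprn_even_gt0 //= ?fmorph_eq0 ?a0.
Qed.

Lemma totally_positive_nat n : (0 < n)%N -> totally_positive (n%:R : K).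
Proof.
move=> n_gt0; split=> [|s _]; last by rewrite rmorph_nat ltr0n.
by rewrite -(rmorph_nat (in_alg K)) fmorph_eq0 pnatr_eq0 -lt0n.
Qed.

Lemma narrow_class_scale a I : totally_positive a ->
  narrow_class (scale_ideal a I) = narrow_class I.
Proof.
move=> pos_a; have [a0 _] := pos_a; apply/seteqP; split=> _ [b pos_b ->].
  by exists (b * a); [exact: totally_positive_mul | rewrite scale_idealA].
exists (b * a^-1); last by rewrite scale_idealA divfK.
by apply: totally_positive_mul => //; exact: totally_positive_inv.
Qed.

Lemma narrow_class_refl I : narrow_class I I.
Proof. by exists 1; [exact: (@totally_positive_nat 1) | rewrite scale_ideal1]. Qed.

(* Multiplication by [Q] is a permutation of 2-power order of the narrow classes,
   of which there are an odd number: it fixes the class of some [I], so that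
   [Q I = c I] with [c] totally positive, and [c^-1 Q] lies in [(I : I) = O]. *)
Lemma odd_narrow_class_principal Q b j :
  odd (narrow_class_number K) -> fractional_ideal Q -> totally_positive b ->
  ideal_exp Q (2 ^ j) = scale_ideal b O ->
  exists2 c, totally_positive c & Q = scale_ideal c O.
Proof.
move=> odd_h fracQ pos_b Qb.
(* Multiplying every member of a class avoids choosing a representative. *)
pose f (C : set (set K)) : set (set K) := [set ideal_mul Q I | I in C].
have fE I : f (narrow_class I) = narrow_class (ideal_mul Q I).
  apply/seteqP; split=> [_ [_ [a pos_a ->] <-]|_ [a pos_a ->]].
    by exists a => //; rewrite scale_ideal_mulr.
  by exists (scale_ideal a I); [exists a | rewrite scale_ideal_mulr].
have iterQ I : fractional_ideal I ->
    iter (2 ^ j) (ideal_mul Q) I = scale_ideal b I.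
  move=> [subI _ _].
  by rewrite ideal_mul_exp // Qb scale_ideal_mull ideal_mulO.
have [_ [I fracI <-]|_ [I fracI <-]|_ [I fracI <-]] :=
    @odd_fset_set_fixpoint _ (narrow_class_group K) f j _ _ odd_h.
- by rewrite fE; exists (ideal_mul Q I) => //; exact: fractional_ideal_mul.
- rewrite -[RHS](narrow_class_scale I pos_b) -(iterQ I fracI).
  by elim: (2 ^ j)%N => //= k ->; rewrite fE.
rewrite fE => fixI; have : narrow_class I (ideal_mul Q I).
  by rewrite -fixI; exact: narrow_class_refl.
move=> [c pos_c QI]; have [c0 _] := pos_c; have [b0 _] := pos_b; exists c => //.
have mulI a e : e != 0 -> (forall y, I y -> scale_ideal e I (a * y)) -> O (e^-1 * a).
  move=> e0 aI; apply: (fractional_multiplier_integral fracI) => y Iy.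
  by rewrite -mulrA; apply/(mem_scale_ideal _ _ e0)/aI.
have subQ : Q `<=` scale_ideal c O.
  move=> q Qq; apply/mem_scale_ideal => //; apply: mulI => // y Iy.
  by rewrite -QI; exact: mem_ideal_mul.
apply/seteqP; split=> // _ [x Ox <-].
have [[Q0 QD QO] _ _] := fracQ.
rewrite mulrC; apply: (QO) => //.
have iterI k : iter k (ideal_mul Q) I = scale_ideal (c ^+ k) I.
  elim: k => [|k IHk]; first by rewrite scale_ideal1.
  by rewrite iterS IHk scale_ideal_mulr QI scale_idealA -exprSr.
(* For the other inclusion, [c] must lie in [Q]. As [c^(2^j) I = Q^(2^j) I = b I], the power
   [c^(2^j)] lies in [b O = Q Q^m] with [m = 2^j - 1]. Since [Q^m] is contained in [c^m O], dividing
   by [c^m] puts [c] in [Q]. *)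
have : ideal_exp Q (2 ^ j) (c ^+ (2 ^ j)).
  rewrite Qb; apply/mem_scale_ideal => //; apply: mulI => // y Iy.
  by rewrite -iterQ // iterI; exists y.
rewrite -[(2 ^ j)%N]prednK ?expn_gt0 //; set m := (2 ^ j).-1.
have expQ k : ideal_exp Q k `<=` scale_ideal (c ^+ k) O.
  rewrite -ideal_exp_principal; elim: k => //= k IHk.
  apply: ideal_mul_sub; [exact: ideal_mul0 | exact: ideal_mulD |].
  by move=> a e Qa Qe; apply: mem_ideal_mul; [exact: subQ | exact: IHk].
suff : ideal_exp Q m.+1 `<=` [set y | Q ((c ^+ m)^-1 * y)].
  by move=> sub /sub /=; rewrite exprSr mulKf // expf_neq0.
apply: ideal_mul_sub => [|y z|y z Qy Qz] /=; first by rewrite mulr0.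
  by rewrite mulrDr; exact: QD.
rewrite mulrCA mulrC; apply: QO => //; apply/mem_scale_ideal; first by rewrite expf_neq0.
exact: expQ.
Qed.

Lemma scale_ideal_eq a b : a != 0 -> b != 0 -> scale_ideal a O = scale_ideal b O ->
  O (b^-1 * a) /\ O (a^-1 * b).
Proof.
move=> a0 b0 eq_ab; split; apply/mem_scale_ideal => //.
  by rewrite -eq_ab; exists 1; [exact: integral1 | rewrite mulr1].
by rewrite eq_ab; exists 1; [exact: integral1 | rewrite mulr1].
Qed.

(** The square of [(a)] has the totally positive generator [a^2], so [(a)] has a totally positive
    generator [c]. Then [a / c] is a unit with the signs of [a]. *)
Lemma odd_narrow_class_signature a :
  odd (narrow_class_number K) -> O a -> a != 0 ->
  exists2 c, totally_positive c & O (c^-1 * a) /\ O (a^-1 * c).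
Proof.
move=> odd_h Oa a0.
have fracQ : fractional_ideal (scale_ideal a O).
  apply: fractional_integral_ideal; first exact: integral_ideal_principal.
  by exists a => //; exists 1; [exact: integral1 | rewrite mulr1].
have [|c pos_c eq_ac] := odd_narrow_class_principal (j := 1) odd_h fracQ (totally_positive_sqr a0).
  exact: ideal_exp_principal.
by exists c => //; apply: scale_ideal_eq => //; case: pos_c.
Qed.

Lemma odd_narrow_class_ramified p n :
  odd (narrow_class_number K) -> \dim {:K} = (2 ^ n)%N -> (0 < p)%N ->
  totally_ramified K p ->
  exists2 c, totally_positive c /\ O c &
    O ((c ^+ (2 ^ n))^-1 * p%:R) /\ O (p%:R^-1 * c ^+ (2 ^ n)).
Proof.
move=> odd_h dimK p_gt0 [P [idealP _ _] ramP].
have pos_p := totally_positive_nat p_gt0; have [p0 _] := pos_p.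
have fracP : fractional_ideal P.
  (* [prime_ideal] admits the zero ideal, which is excluded here because its powers with positive
     exponent do not contain [p]. *)
  apply: fractional_integral_ideal => //; apply: contrapT => P0.
  have : scale_ideal p%:R O p%:R by exists 1; [exact: integral1 | rewrite mulr1].
  rewrite ramP dimK -[(2 ^ n)%N]prednK ?expn_gt0 //.
  suff sub0 : ideal_exp P (2 ^ n).-1.+1 `<=` [set 0].
    by move/sub0 => /= p00; rewrite p00 eqxx in p0.
  apply: ideal_mul_sub => [|x y|x y Px _] //=; first by move=> -> ->; rewrite addr0.
  have [->|x0] := eqVneq x 0; first by rewrite mul0r.
  by case: P0; exists x.
rewrite dimK in ramP.
have [c pos_c Pc] := odd_narrow_class_principal odd_h fracP pos_p (esym ramP).
have [c0 _] := pos_c; exists c.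
  split=> //; case: idealP => _; apply; rewrite Pc.
  by exists 1; [exact: integral1 | rewrite mulr1].
apply: scale_ideal_eq => //; first by rewrite expf_neq0.
by rewrite ramP Pc ideal_exp_principal.
Qed.

End Ideals.

(** * Units *)

Definition integer_unit (K : fieldExtType rat) (u : K) :=
  [/\ u != 0, ring_of_integers u & ring_of_integers u^-1].

Lemma integer_unit_mul (K : fieldExtType rat) (u v : K) :
  integer_unit u -> integer_unit v -> integer_unit (u * v).
Proof.
move=> [u0 Ou OVu] [v0 Ov OVv]; split; first by rewrite mulf_neq0.
  exact: integral_mul.
by rewrite invfM; exact: integral_mul.
Qed.

Lemma integer_unit_inv (K : fieldExtType rat) (u : K) :
  integer_unit u -> integer_unit u^-1.
Proof. by move=> [u0 Ou OVu]; split; rewrite ?invr_eq0 ?invrK. Qed.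

Lemma integer_unit1 (K : fieldExtType rat) : integer_unit (1 : K).
Proof. by split; rewrite ?invr1 ?oner_neq0 //; exact: integral1. Qed.

Lemma integer_unit_prod (K : fieldExtType rat) (I : finType) (f : I -> K) (a : I -> nat) :
  (forall i, integer_unit (f i)) -> integer_unit (\prod_i f i ^+ a i).
Proof.
move=> unit_f; apply: (big_ind (@integer_unit K)) => [||i _].
- exact: integer_unit1.
- exact: integer_unit_mul.
elim: (a i) => [|k IHk]; first exact: integer_unit1.
by rewrite exprS; exact: integer_unit_mul.
Qed.

(* Equals [H] plus the integer part of the binary logarithm of [r], for [r >= 2^-H]. *)
Definition log_code (H : nat) (r : algC) : nat :=
  trunc_log 2 (Num.truncn (2 ^+ H * r)).

Lemma log_codeP (H : nat) (r : algC) : 2 ^- H <= r ->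
  2 ^+ log_code H r <= 2 ^+ H * r < 2 ^+ (log_code H r).+1.
Proof.
move=> le_r; set x := 2 ^+ H * r.
have x_ge1 : 1 <= x by rewrite -ler_pdivrMl ?exprn_gt0 // mulr1.
have x_ge0 : 0 <= x by apply: le_trans x_ge1.
have /andP[le_nx lt_xn] := truncn_itv x_ge0.
have n_gt0 : (0 < Num.truncn x)%N by rewrite truncn_gt0.
have /andP[le_kn lt_nk] := trunc_log_bounds (leqnn 2) n_gt0.
rewrite /log_code -/x -!natrX; apply/andP; split.
  by apply: le_trans le_nx; rewrite ler_nat.
by apply: lt_le_trans lt_xn _; rewrite ler_nat.
Qed.

Lemma log_code_le (H : nat) (r : algC) : 2 ^- H <= r <= 2 ^+ H -> (log_code H r <= H + H)%N.
Proof.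
move=> /andP[r_ge r_le]; rewrite -(trunc_expnK (H + H) (leqnn 2)).
apply: leq_trunc_log; rewrite -(ler_nat algC) natrX exprD.
have r_ge0 : 0 <= r by apply: le_trans r_ge; rewrite invr_ge0 exprn_ge0.
apply: (@le_trans _ _ (2 ^+ H * r)); last by rewrite ler_pM2l ?exprn_gt0.
by rewrite truncn_le mulr_ge0 // exprn_ge0.
Qed.

(** After scaling by [2^H], both numbers lie in the same dyadic interval. *)
Lemma log_code_eq (H : nat) (r1 r2 : algC) : 2 ^- H <= r1 -> 2 ^- H <= r2 ->
  log_code H r1 = log_code H r2 -> r2^-1 * r1 <= 2.
Proof.
move=> r1_ge r2_ge eq_code.
have r2_gt0 : 0 < r2 by apply: lt_le_trans r2_ge; rewrite invr_gt0 exprn_gt0.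
have /andP[_ lt1] := log_codeP r1_ge; have /andP[le2 _] := log_codeP r2_ge.
rewrite ler_pdivrMl // -(ler_pM2l (_ : 0 < 2 ^+ H)) ?exprn_gt0 //.
apply: le_trans (ltW lt1) _; rewrite eq_code exprSr mulrA ler_pM2r //.
Qed.

Section Units.

Variables (K : fieldExtType rat) (t : K).
Local Notation d := (\dim {:K}).
Variable s : 'I_d -> {rmorphism K -> algC}.
Hypothesis conj_s : conjugate_system t s.

(* An integer is determined by its traces against the powers of [t], which are integers,
   and bounded when the conjugates are. *)
Lemma bounded_integers_code (B : algC) :
  exists (n : nat) (code : K -> {ffun 'I_d -> 'I_n}),
    forall x y, ring_of_integers x -> ring_of_integers y ->
      (forall i, `|s i x| <= B) -> (forall i, `|s i y| <= B) ->
      code x = code y -> x = y.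
Proof.
have [Ot _ _] := conj_s.
have OX k : ring_of_integers (t ^+ k).
  by elim: k => [|k IHk]; [exact: integral1 | rewrite exprS; exact: integral_mul].
pose c := \sum_(k < d) \sum_i `|B| * `|s i t| ^+ k.
have c_ge0 : 0 <= c.
  by apply: sumr_ge0 => k _; apply: sumr_ge0 => i _; rewrite mulr_ge0 ?exprn_ge0.
pose m := Num.bound c.
have tr_le x (k : 'I_d) : (forall i, `|s i x| <= B) -> `|\sum_i s i (x * t ^+ k)| <= m%:R.
  move=> x_le; apply: (@le_trans _ _ c); last exact/ltW/archi_boundP.
  rewrite /c [leRHS](bigD1 k) //=; apply: ler_wpDr.
    by apply: sumr_ge0 => l _; apply: sumr_ge0 => i _; rewrite mulr_ge0 ?exprn_ge0.
  apply: le_trans (ler_norm_sum _ _ _) _; apply: ler_sum => i _.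
  rewrite rmorphM rmorphXn normrM normrX ler_wpM2r ?exprn_ge0 //.
  by apply: le_trans (x_le i) _; rewrite real_ler_norm // ger0_real // (le_trans _ (x_le i)).
(* Traces are integers between [-m] and [m]; the shift by [m] makes them natural numbers below
   [2m + 1], so neither [truncn] nor [inord] loses information. *)
exists (m + m).+1, (fun x => [ffun k : 'I_d => inord (Num.truncn (\sum_i s i (x * t ^+ k) + m%:R))]).
move=> x y Ox Oy x_le y_le /ffunP eq_code; apply/eqP; rewrite -subr_eq0; apply/eqP.
apply: (trace_form_nondegenerate conj_s) => k.
have codeE z : ring_of_integers z -> (forall i, `|s i z| <= B) ->
    \sum_i s i (z * t ^+ k) =
      (inord (Num.truncn (\sum_i s i (z * t ^+ k) + m%:R)) : 'I_(m + m).+1)%:R - m%:R.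
  move=> Oz z_le; set T := \sum_i _.
  have T_int : T \is a Num.int by apply: (trace_int conj_s); apply: integral_mul => //; exact: OX.
  have T_real : T \is Num.real := Rreal_int T_int.
  have : `|T| <= m%:R := tr_le z k z_le; rewrite real_ler_norml // => /andP[T_ge T_le].
  have Tm_nat : T + m%:R \is a Num.nat.
    rewrite natrEint; apply/andP; split; last by rewrite -lerBlDr sub0r.
    by rewrite rpredD // rpred_nat.
  rewrite inordK; last by rewrite ltnS -(ler_nat algC) truncnK // natrD lerD2r.
  by rewrite truncnK // addrK.
have -> : \sum_i s i ((x - y) * t ^+ k) = \sum_i s i (x * t ^+ k) - \sum_i s i (y * t ^+ k).
  by rewrite -sumrB; apply: eq_bigr => i _; rewrite -rmorphB mulrBl.
rewrite (codeE x) // (codeE y) //.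
by have := eq_code k; rewrite !ffunE => ->; rewrite subrr.
Qed.

(* Pigeonhole: among the [N^d] products with exponents below [N], the sizes up to a factor
   2 at all embeddings but one take [O(N^(d-1))] values, the last one being determined by
   the norm; the quotient of two products of the same size lies in a finite set. *)
Lemma units_dependent (f : 'I_d -> K) : (forall i, integer_unit (f i)) ->
  exists (a b : 'I_d -> nat),
    (exists i, a i <> b i) /\ \prod_i f i ^+ a i = \prod_i f i ^+ b i.
Proof.
move=> unit_f.
have [M M_le] : exists M : nat, forall i j, 2 ^- M <= `|s j (f i)| <= 2 ^+ M.
  pose c := \sum_i \sum_j (`|s j (f i)| + `|s j (f i)|^-1).
  have c_le i j : `|s j (f i)| + `|s j (f i)|^-1 <= c.
    rewrite /c (bigD1 i) //= (bigD1 j) //= -addrA; apply: ler_wpDr => //.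
    apply: addr_ge0; apply: sumr_ge0 => k _; last apply: sumr_ge0 => l _;
      by rewrite addr_ge0 ?invr_ge0.
  have c_ge0 : 0 <= c.
    by apply: sumr_ge0 => i _; apply: sumr_ge0 => j _; rewrite addr_ge0 ?invr_ge0.
  have c_lt : c <= 2 ^+ Num.bound c.
    apply: le_trans (ltW (archi_boundP c_ge0)) _.
    by rewrite -natrX ler_nat ltnW // ltn_expl.
  exists (Num.bound c) => i j; have [f0 _ _] := unit_f i.
  have sf_gt0 : 0 < `|s j (f i)| by rewrite normr_gt0 fmorph_eq0.
  have := le_trans (c_le i j) c_lt => le_c; apply/andP; split.
    rewrite invf_ple ?posrE ?exprn_gt0 //; apply: le_trans le_c.
    by rewrite lerDr ltW.
  by apply: le_trans le_c; rewrite lerDl invr_ge0 ltW.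
have [n [code codeP]] := bounded_integers_code (2 ^+ d).
pose j0 : 'I_d := Ordinal (adim_gt0 {:K}%AS).
pose X : finType := {j : 'I_d | j != j0}.
have cardX : #|X| = d.-1 by rewrite card_sig -[in RHS](card_ord d) -(cardC1 j0); apply: eq_card.
pose C := (d * M + d * M).+1.
(* [H] bounds the binary logarithms of all products with exponents at most [N], and
   [2H + 1 <= C (N+1)]. Hence there are at most [(C (N+1))^(d-1) n^d = N (N+1)^(d-1)] codes, fewer
   than the [(N+1)^d] exponent vectors. *)
pose N := (C ^ d.-1 * n ^ d)%N.
pose H := (d * M * N)%N.
pose y (a : {ffun 'I_d -> 'I_N.+1}) := \prod_i f i ^+ a i.
have unit_y a : integer_unit (y a) by exact: integer_unit_prod.
have y_bound a j : 2 ^- H <= `|s j (y a)| <= 2 ^+ H.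
  have -> : `|s j (y a)| = \prod_i `|s j (f i)| ^+ a i.
    by rewrite rmorph_prod normr_prod; apply: eq_bigr => i _; rewrite rmorphXn normrX.
  have HE (x : algC) : x ^+ H = \prod_(i < d) (x ^+ M) ^+ N.
    by rewrite prodr_const card_ord -!exprM /H -(mulnA d M N) (mulnC d (M * N)) -(mulnA M N d).
  rewrite -exprVn !HE; apply/andP; split; apply: ler_prod => i _.
    have /andP[le1 le2] := M_le i j; apply/andP; split.
      by rewrite !exprn_ge0 // invr_ge0.
    rewrite exprVn; apply: (@le_trans _ _ ((2 ^- M) ^+ a i)).
      apply: ler_wiXn2l; last by rewrite -ltnS.
        by rewrite invr_ge0 exprn_ge0.
      by rewrite invf_le1 ?exprn_gt0 // exprn_ege1 // ler1n.
    by apply: lerXn2r; rewrite ?nnegrE ?invr_ge0 ?exprn_ge0.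
  have /andP[le1 le2] := M_le i j; apply/andP; split; first by rewrite exprn_ge0.
  apply: (@le_trans _ _ ((2 ^+ M) ^+ a i)).
    by apply: lerXn2r; rewrite ?nnegrE ?exprn_ge0.
  apply: ler_weXn2l; last by rewrite -ltnS.
  by rewrite exprn_ege1 // ler1n.
pose Phi a : {ffun X -> 'I_(H + H).+1} := [ffun j => inord (log_code H `|s (val j) (y a)|)].
have PhiP a b : Phi a = Phi b -> forall j, `|s j (y a / y b)| <= 2 ^+ d.
  move=> /ffunP eqPhi.
  have code_eq j : j != j0 -> log_code H `|s j (y a)| = log_code H `|s j (y b)|.
    move=> jj0; have := eqPhi (Sub j jj0); rewrite !ffunE /= => /(congr1 val) /=.
    by rewrite !inordK // ltnS log_code_le ?y_bound.
  have sE c e j : `|s j (y c / y e)| = `|s j (y e)|^-1 * `|s j (y c)|.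
    by rewrite rmorphM fmorphV normrM normfV mulrC.
  have lbound c j : 2 ^- H <= `|s j (y c)| by have /andP[] := y_bound c j.
  have le2 c e : (forall j, j != j0 -> log_code H `|s j (y c)| = log_code H `|s j (y e)|) ->
      forall j, j != j0 -> `|s j (y c / y e)| <= 2.
    by move=> code_ce j jj0; rewrite sE; apply: (@log_code_eq H) => //; exact: code_ce.
  have d_gt0 : (0 < d)%N := adim_gt0 {:K}%AS.
  move=> j; have [->|jj0] := eqVneq j j0; last first.
    apply: le_trans (le2 a b code_eq j jj0) _.
    by rewrite -[leLHS]expr1; apply: ler_weXn2l => //; rewrite ler1n.
  have [w0 Ow OVw] : integer_unit (y b / y a).
    by apply: integer_unit_mul => //; exact: integer_unit_inv.
  (* At [j0] the quotient has the size of the product of its inverse over the other embeddings, by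
     the norm; each of those [d - 1] factors is at most 2. *)
  have := norm_unit conj_s w0 Ow OVw; rewrite (bigD1 j0) //= => prod1.
  have inv_ab : `|s j0 (y a / y b)| * `|s j0 (y b / y a)| = 1.
    have [ya0 _ _] := unit_y a; have [yb0 _ _] := unit_y b.
    by rewrite -normrM -rmorphM mulrA divfK // divff // rmorph1 normr1.
  have -> : `|s j0 (y a / y b)| = \prod_(i < d | i != j0) `|s i (y b / y a)|.
    apply: (@mulfI _ `|s j0 (y b / y a)|); first by rewrite normr_eq0 fmorph_eq0.
    by rewrite mulrC inv_ab prod1.
  apply: (@le_trans _ _ (\prod_(i < d | i != j0) 2)).
    apply: ler_prod => i ii0; rewrite normr_ge0 /=.
    by apply: le2 => // k kk0; rewrite code_eq.
  rewrite prodr_const; apply: ler_weXn2l; first by rewrite ler1n.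
  by rewrite -[leqRHS](card_ord d) max_card.
(* Dividing by a fixed representative of each size class gives integers bounded by [2^d], which
   [code] can tell apart. The default is never taken at values of [Phi]. *)
pose rep v := odflt [ffun=> ord0] [pick b | Phi b == v].
have repP a : Phi (rep (Phi a)) = Phi a.
  by rewrite /rep; case: pickP => [b /eqP //|/(_ a)]; rewrite eqxx.
pose G a := (Phi a, code (y a / y (rep (Phi a)))).
have /injectivePn[a [b ab eqG]] : ~~ injectiveb G.
  apply/negP => /injectiveP/leq_card; apply/negP; rewrite -ltnNge.
  rewrite card_prod !card_ffun !card_ord cardX.
  have -> : (N.+1 ^ d = N.+1 ^ d.-1 * N.+1)%N by rewrite -expnSr prednK // adim_gt0.
  apply: (@leq_ltn_trans ((C * N.+1) ^ d.-1 * n ^ d)).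
    rewrite leq_mul2r; apply/orP; right.
    case: (d.-1) => // e; rewrite leq_exp2r // /C mulSn.
    by rewrite -[(H + H).+1]add1n leq_add // /H -mulnDl leq_mul2l leqnSn orbT.
  by rewrite expnMn mulnAC mulnC ltn_pmul2l ?expn_gt0.
move: eqG => -[eqPhi]; rewrite eqPhi => eq_code.
have yab : y a / y (rep (Phi b)) = y b / y (rep (Phi b)).
  have unit_r c : integer_unit (y c / y (rep (Phi b))).
    by apply: integer_unit_mul => //; exact: integer_unit_inv.
  have [_ Oa _] := unit_r a; have [_ Ob _] := unit_r b.
  by apply: codeP => //; apply: PhiP; rewrite repP.
have [r0 _ _] := unit_y (rep (Phi b)).
exists (fun i => nat_of_ord (a i)), (fun i => nat_of_ord (b i)); split; last exact: (divIf r0 yab).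
apply: contrapT => eq_ab; case/eqP: ab; apply/ffunP => i; apply: val_inj.
by apply: contrapT => ne; apply: eq_ab; exists i.
Qed.

(** * Signs of conjugates and relations modulo squares *)

Hypothesis realK : totally_real K.

Lemma sqr_conj_ge0 (i : 'I_d) (x : K) : 0 <= s i (x ^+ 2).
Proof. by rewrite rmorphXn real_exprn_even_ge0 //; exact: realK. Qed.

Lemma sqr_eqN (x y : K) : x ^+ 2 = - y ^+ 2 -> y = 0.
Proof.
move=> xy; pose i : 'I_d := Ordinal (adim_gt0 {:K}%AS).
have : y ^+ 2 == 0; last by rewrite expf_eq0 => /eqP.
rewrite -(fmorph_eq0 (s i)).
rewrite eq_le sqr_conj_ge0 andbT -oppr_ge0 -rmorphN -xy.
exact: sqr_conj_ge0.
Qed.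

(* Halve the exponents until some [a i] and [b i] have different parity; the sign lost in
   taking square roots is harmless since [-1] is not a square. *)
Lemma dependent_mod_squares (k : nat) (f : 'I_d -> K) (a b : 'I_d -> nat) :
  (forall i, f i != 0) -> (forall i, a i < 2 ^ k)%N -> (forall i, b i < 2 ^ k)%N ->
  (exists i, a i <> b i) ->
  (\prod_i f i ^+ a i) ^+ 2 = (\prod_i f i ^+ b i) ^+ 2 ->
  exists (B : {set 'I_d}) (z : K),
    B != finset.set0 /\ (z ^+ 2 * \prod_(i in B) f i) ^+ 2 = 1.
Proof.
move=> f0; have prod0 (c : 'I_d -> nat) : \prod_i f i ^+ c i != 0.
  by apply/prodf_neq0 => i _; rewrite expf_neq0.
have half2 (c : 'I_d -> nat) : \prod_i f i ^+ c i =
    (\prod_i f i ^+ (c i)./2) ^+ 2 * \prod_i f i ^+ odd (c i).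
  rewrite -prodrXl -big_split; apply: eq_bigr => i _ /=.
  by rewrite -exprM -exprD muln2 addnC odd_double_half.
elim: k a b => [|k IHk] a b a_lt b_lt [i0 ab] eq_ab.
  case: ab; move: (a_lt i0) (b_lt i0); rewrite expn0 !ltnS !leqn0.
  by move=> /eqP -> /eqP ->.
pose B := [set i | odd (a i + b i)]%SET.
have [B0|] := eqVneq B finset.set0; last first.
  move=> B_neq0; exists B.
  (* With this [z], [z^2] times the product over [B] is the quotient of the two given products,
     whose square is 1. *)
  exists (\prod_i f i ^+ (a i + b i)./2 / \prod_i f i ^+ b i); split => //.
  have -> : \prod_(i in B) f i = \prod_i f i ^+ odd (a i + b i).
    rewrite big_mkcond; apply: eq_bigr => i _; rewrite inE.
    by case: (odd _).
  rewrite expr_div_n mulrAC -half2.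
  have -> : \prod_i f i ^+ (a i + b i) = (\prod_i f i ^+ a i) * \prod_i f i ^+ b i.
    by rewrite -big_split; apply: eq_bigr => i _; rewrite exprD.
  rewrite [X in _ / X]expr2 invfM mulrA mulfK // expr_div_n eq_ab divff //.
  exact: expf_neq0.
have odd_ab i : odd (a i) = odd (b i).
  have : i \notin B by rewrite B0 inE.
  by rewrite inE oddD negb_add => /eqP.
apply: (IHk (fun i => (a i)./2) (fun i => (b i)./2)).
- by move=> i; rewrite ltn_half_double -mul2n -expnS.
- by move=> i; rewrite ltn_half_double -mul2n -expnS.
- exists i0 => eq_half; apply: ab.
  by rewrite -[LHS]odd_double_half -[RHS]odd_double_half eq_half odd_ab.
set A' := \prod_i _; set B' := \prod_i _.
move: eq_ab; rewrite (half2 a) (half2 b) -/A' -/B'.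
have -> : \prod_i f i ^+ odd (a i) = \prod_i f i ^+ odd (b i).
  by apply: eq_bigr => i _; rewrite odd_ab.
rewrite !exprMn => /(mulIf (expf_neq0 2 (prod0 _))) /eqP.
rewrite eqf_sqr => /orP[/eqP //|/eqP/sqr_eqN B'0].
by have := prod0 (fun i => (b i)./2); rewrite -/B' B'0 eqxx.
Qed.

(** These elements realise a basis of the sign vectors; [odd_narrow_class_signature] turns them into
    units. *)
Lemma signature_element (i0 : 'I_d) :
  exists a : K, [/\ ring_of_integers a, s i0 a < 0 & forall j, j != i0 -> 0 < s j a].
Proof.
have [Ot _ inj_s] := conj_s.
have realt j : s j t \is Num.real by exact: realK.
(* The sum dominates every bound at once; its term at [i0] is harmless, since [3 / 0 = 0]. *)
pose N := (\sum_j Num.bound (3 / `|s j t - s i0 t|)%R)%N.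
have N_gt j : j != i0 -> 3 < N%:R * `|s j t - s i0 t|.
  move=> ji0; have dist_gt0 : 0 < `|s j t - s i0 t|.
    by rewrite normr_gt0 subr_eq0; apply: contra ji0 => /eqP/inj_s ->.
  rewrite -ltr_pdivrMr //; apply: lt_le_trans (archi_boundP _) _.
    by rewrite divr_ge0 ?ler0n // ltW.
  by rewrite ler_nat /N (bigD1 j) //= leq_addr.
pose q := Num.floor (N%:R * s i0 t).
have realNt : N%:R * s i0 t \is Num.real by rewrite rpredM ?realn.
have /andP[q_le q_lt] := real_floor_itv realNt.
pose e := N%:R * s i0 t - q%:~R.
have e_ge0 : 0 <= e by rewrite subr_ge0.
have e_lt1 : e < 1 by rewrite ltrBlDl; move: q_lt; rewrite intrD.
have sE j : s j ((N%:R * t - q%:~R) ^+ 2 - 2%:R) = (N%:R * s j t - q%:~R) ^+ 2 - 2.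
  by rewrite rmorphB rmorphXn rmorphB rmorphM rmorph_int !rmorph_nat.
(* Negative only within [sqrt 2] of [q], where [N] has been chosen so that the
   conjugates of [N t] are more than 3 apart from the one at [i0]. *)
exists ((N%:R * t - q%:~R) ^+ 2 - 2%:R); split.
- apply: integral_sub; last exact: integral_nat.
  have Ox : ring_of_integers (N%:R * t - q%:~R).
    apply: integral_sub; last exact: integral_id.
    by apply: integral_mul => //; exact: integral_nat.
  by rewrite expr2; exact: integral_mul.
- rewrite sE subr_lt0 -/e; apply: (@lt_trans _ _ 1); last by rewrite ltr1n.
  by rewrite expr_lt1.
move=> j ji0; rewrite sE subr_gt0.
have -> : N%:R * s j t - q%:~R = N%:R * (s j t - s i0 t) + e.
  by rewrite mulrBr /e addrA subrK.
set D := N%:R * _.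
have D_real : D \is Num.real by rewrite rpredM ?realn ?rpredB.
have e_real : e \is Num.real := ger0_real e_ge0.
have D_gt3 : 3 < `|D| by rewrite normrM normr_nat; exact: N_gt.
have De_gt2 : 2 < `|D + e|.
  have : `|D| <= `|D + e| + `|e|.
    by rewrite -{1}[D](addrK e) (le_trans (ler_normB _ _)).
  rewrite (ger0_norm e_ge0) => le_D.
  rewrite -(ltrD2r 1) natr1; apply: lt_trans D_gt3 _; apply: le_lt_trans le_D _.
  by rewrite ltrD2l.
rewrite -(real_normK (realD D_real e_real)).
apply: (@lt_trans _ _ (2 ^+ 2)); first by rewrite -natrX ltr_nat.
by rewrite ltr_pXn2r ?nnegrE ?normr_ge0 ?ler0n.
Qed.

End Units.

(** Take units [e i] negative at the embedding [i] only, and replace [e i0] by [u]. The rank bound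
    gives a nontrivial relation modulo squares among these units, up to sign, and comparing signs
    leaves only [u] in it. *)
Lemma totally_positive_unit_square (K : fieldExtType rat) (u : K) :
  totally_real K -> odd (narrow_class_number K) ->
  integer_unit u -> totally_positive u -> exists v, u = v ^+ 2.
Proof.
move=> realK odd_h unit_u [u0 pos_u].
have [t [s conj_s]] := number_field_embeddings K.
have /choice[e eP] (i : 'I_(\dim {:K})) : exists e : K,
    [/\ integer_unit e, s i e < 0 & forall j, j != i -> 0 < s j e].
  have [a [Oa a_neg a_pos]] := signature_element conj_s realK i.
  have a0 : a != 0 by apply: contraTneq a_neg => ->; rewrite rmorph0 ltxx.
  have [c [c0 pos_c] [Oac Oca]] := odd_narrow_class_signature odd_h Oa a0.
  have cV_gt0 j : 0 < s j c^-1 by rewrite fmorphV invr_gt0; apply: pos_c; exact: realK.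
  exists (c^-1 * a); split.
  - by split; rewrite ?mulf_neq0 ?invr_neq0 // invfM invrK mulrC.
  - by rewrite rmorphM pmulr_rlt0.
  - by move=> j ji; rewrite rmorphM mulr_gt0 // a_pos.
pose i0 : 'I_(\dim {:K}) := Ordinal (adim_gt0 {:K}%AS).
(* [-1] is up to squares the product of all the [e i], so one of these can be traded
   for [u]. *)
pose f i := if i == i0 then u else e i.
have unit_f i : integer_unit (f i) by rewrite /f; case: ifP => // _; case: (eP i).
have f0 i : f i != 0 by case: (unit_f i).
have [a [b [ab eq_ab]]] := units_dependent conj_s unit_f.
pose k := (\sum_i (a i + b i))%N.
have k_gt i : (a i + b i < 2 ^ k)%N.
  by apply: leq_ltn_trans (ltn_expl _ (leqnn 2)); rewrite /k (bigD1 i) //= leq_addr.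
have [||B [z [B_neq0 zB]]] :=
    dependent_mod_squares (k := k) s realK f0 _ _ ab (congr1 (fun x => x ^+ 2) eq_ab).
- by move=> i; apply: leq_ltn_trans (k_gt i); rewrite leq_addr.
- by move=> i; apply: leq_ltn_trans (k_gt i); rewrite leq_addl.
have f_pos j i : i != j \/ i = i0 -> 0 < s j (f i).
  rewrite /f; case: (eqVneq i i0) => [_ _|ii0 [ij|/eqP]]; last by rewrite (negPf ii0).
    by apply: pos_u; exact: realK.
  by have [_ _ ->] := eP i; rewrite // eq_sym.
have z0 : z != 0.
  by apply: contraTneq (oner_neq0 K) => z0; rewrite -zB z0 expr0n /= mul0r expr0n eqxx.
have z_pos j : 0 < s j (z ^+ 2).
  have [_] := totally_positive_sqr z0; apply; exact: realK.
(* At [i0] every factor is positive, which excludes the value [-1]. *)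
have zB1 : z ^+ 2 * \prod_(i in B) f i = 1.
  move/eqP: zB; rewrite -[X in _ == X -> _](expr1n _ 2) eqf_sqr.
  move=> /orP[/eqP //|/eqP zBN].
  have : 0 < s i0 (z ^+ 2 * \prod_(i in B) f i).
    rewrite rmorphM mulr_gt0 // rmorph_prod prodr_gt0 // => i _; apply: f_pos.
    by have [->|] := eqVneq i i0; [right | left].
  by rewrite zBN rmorphN rmorph1 oppr_gt0 ltr10.
(* If [B] contained some other [i], the product would be negative at [i], where [e i] is the only
   negative factor. *)
have subB i : i \in B -> i = i0.
  move=> Bi; apply/eqP/negPn/negP => ii0.
  have : s i (z ^+ 2 * \prod_(i in B) f i) < 0.
    rewrite (bigD1 i) //= rmorphM pmulr_rlt0 // rmorphM pmulr_llt0.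
      by rewrite /f (negPf ii0); case: (eP i).
    by rewrite rmorph_prod prodr_gt0 // => j /andP[_ ji]; apply: f_pos; left.
  by rewrite zB1 rmorph1 ltr10.
have defB : B = [set i0]%SET.
  have /set0Pn[i Bi] := B_neq0; apply/setP => j; rewrite inE.
  by apply/idP/eqP => [/subB //|->]; rewrite -(subB _ Bi).
exists z^-1; move: zB1; rewrite defB big_set1 /f eqxx => zu.
by rewrite exprVn -[LHS](mulKf (expf_neq0 2 z0)) zu mulr1.
Qed.

(** * The tower of square roots and the cyclotomic field *)

Lemma integer_unit_factor (K : fieldExtType rat) (x y : K) :
  ring_of_integers x -> ring_of_integers y -> integer_unit (x * y) -> integer_unit x.
Proof.
move=> Ox Oy [xy0 _ OVxy]; have [x0 y0] : x != 0 /\ y != 0.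
  by apply/andP; rewrite -negb_or -mulf_eq0.
split=> //; have -> : x^-1 = (x * y)^-1 * y by rewrite invfM mulfVK.
exact: integral_mul.
Qed.

Lemma integral_sqrt (K : fieldExtType rat) (v : K) :
  ring_of_integers (v ^+ 2) -> ring_of_integers v.
Proof.
move=> Ov2; apply: (@integral_root_monic _ _ intr _ ('X^2 - (v ^+ 2)%:P)).
- exact: monicXnsubC.
- by rewrite rootE !hornerE subrr.
- apply/integral_poly => i; rewrite coefB coefXn coefC; apply: integral_sub.
    exact: integral_nat.
  by case: ifP => // _; exact: integral0.
Qed.

Lemma sum_prod_gt0 (x y : algC) : x \is Num.real -> y \is Num.real ->
  0 < x + y -> 0 < x * y -> 0 < x.
Proof.
move=> xr yr xy_gt0 xyM_gt0; rewrite real_ltNge ?real0 //; apply/negP => x_le0.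
have x_lt0 : x < 0.
  by rewrite lt_neqAle x_le0 andbT; apply: contraTneq xyM_gt0 => ->; rewrite mul0r ltxx.
move: xyM_gt0; rewrite nmulr_rgt0 // => y_lt0.
have xy_lt0 : x + y < 0 by rewrite -[ltRHS]addr0 ltrD.
by have := lt_trans xy_gt0 xy_lt0; rewrite ltxx.
Qed.

(** The doubling map: it sends [z + z^-1] to [z^2 + z^-2]. *)
Definition square_sub2 (R : nzRingType) (x : R) : R := x ^+ 2 - 2%:R.

(* The invariant carried up the tower [x_0 = 0], [x_{k+1}^2 = 2 + x_k]: the elements
   [2 + x_k] and [2 - x_k] both generate the [2^(n-k)]-th power of the prime [(c)]
   above 2, and [2 + x_k], being totally positive, is then a square. *)
Lemma sqrt_tower (K : fieldExtType rat) (n : nat) :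
  \dim {:K} = (2 ^ n)%N -> totally_real K -> totally_ramified K 2 ->
  odd (narrow_class_number K) -> exists x : K, iter n (@square_sub2 K) x = 0.
Proof.
move=> dimK realK ram2 odd_h.
have [c [pos_c Oc] [Ou OVu]] := odd_narrow_class_ramified odd_h dimK (isT : (0 < 2)%N) ram2.
have [c0 _] := pos_c; have [two0 _] := @totally_positive_nat K 2 isT.
have OX k : ring_of_integers (c ^+ k).
  by elim: k => [|k IHk]; [exact: integral1 | rewrite exprS; exact: integral_mul].
have posX k : totally_positive (c ^+ k).
  elim: k => [|k IHk]; first exact: (@totally_positive_nat K 1).
  by rewrite exprS; exact: totally_positive_mul.
set u2 := (c ^+ (2 ^ n))^-1 * 2%:R in Ou.
have two_eq : 2%:R = u2 * c ^+ (2 ^ n) by rewrite mulrC mulVKf // expf_neq0.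
have unit_u2 : integer_unit u2.
  by split=> //; rewrite ?mulf_neq0 ?invr_neq0 ?expf_neq0 // invfM invrK mulrC.
suff tower k : (k <= n)%N -> exists x : K, [/\ iter k (@square_sub2 K) x = 0,
    integer_unit ((2%:R + x) / c ^+ (2 ^ (n - k))),
    integer_unit ((2%:R - x) / (2%:R + x)),
    totally_positive (2%:R + x) & totally_positive (2%:R - x)].
  by have [x [xn _ _ _ _]] := tower n (leqnn n); exists x.
elim: k => [_|k IHk lt_kn].
  exists 0; rewrite addr0 subr0 subn0 divff //; split=> //.
  - by rewrite mulrC.
  - exact: integer_unit1.
  - exact: totally_positive_nat.
  - exact: totally_positive_nat.
have [x [xk unit_u unit_r pos1 pos2]] := IHk (ltnW lt_kn).
have [px0 _] := pos1; have [mx0 _] := pos2.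
set m := (2 ^ (n - k.+1))%N.
have m2 : (2 ^ (n - k) = m * 2)%N by rewrite /m subnS mulnC -expnS prednK // subn_gt0.
(* A totally positive unit is a square, and the exponent of [c] is the even number [2m]; so [2 + x]
   is the square of [v c^m]. *)
have [v def_u] : exists v, (2%:R + x) / c ^+ (2 ^ (n - k)) = v ^+ 2.
  apply: totally_positive_unit_square => //; apply: totally_positive_mul => //.
  exact: totally_positive_inv.
rewrite def_u in unit_u; have [v20 Ov2 OVv2] := unit_u.
have v0 : v != 0 by apply: contraNneq v20 => ->; rewrite expr0n.
have unit_v : integer_unit v.
  by split=> //; apply: integral_sqrt; rewrite ?exprVn.
pose y := v * c ^+ m.
have y0 : y != 0 by rewrite mulf_neq0 ?expf_neq0.
have y2 : y ^+ 2 = 2%:R + x.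
  by rewrite exprMn -exprM -m2 -def_u divfK // expf_neq0.
(* Up to units this is [c^(2^n - m)], with [m <= 2^n]. It allows [y] to be factored out of [2 + y]
   and [2 - y]. *)
have O2y : ring_of_integers (2%:R / y).
  have -> : 2%:R / y = u2 * v^-1 * c ^+ (2 ^ n - m).
    apply: (canLR (mulfK y0)); rewrite /y mulrACA -[_ * _ * v]mulrA mulVf // mulr1.
    by rewrite -exprD subnK ?two_eq // leq_exp2l // leq_subr.
  apply: integral_mul; last exact: OX.
  case: unit_u2 => _ ? _; case: unit_v => _ _ ?.
  exact: integral_mul.
pose e1 := 1 + 2%:R / y; pose e2 := 1 - 2%:R / y.
have Oe1 : ring_of_integers e1 by apply: integral_add; [exact: integral1 | exact: O2y].
have Oe2 : ring_of_integers e2 by apply: integral_sub; [exact: integral1 | exact: O2y].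
have unit_N1 : integer_unit (-1 : K).
  by split; rewrite ?oppr_eq0 ?oner_neq0 ?invrN1 //; apply/integral_opp/integral1.
have e1y : 2%:R + y = y * e1 by rewrite mulrDr mulr1 mulrC divfK // addrC.
have e2y : 2%:R - y = - y * e2 by rewrite mulrBr mulr1 mulNr opprK mulrC divfK // addrC.
have four : 2%:R ^+ 2 = 2%:R + 2%:R :> K by rewrite -natrX -natrD.
have pmE : (2%:R + y) * (2%:R - y) = 2%:R - x.
  by rewrite mulrC -subr_sqr y2 four opprD addrA addrK.
(* From [(2 + y)(2 - y) = 2 - x] and [y^2 = 2 + x], the product is minus the unit ratio of the
   invariant; both integral factors are then units. *)
have unit_e12 : integer_unit (e1 * e2).
  have -> : e1 * e2 = -1 * ((2%:R - x) / (2%:R + x)).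
    rewrite mulN1r; apply: (canRL opprK); apply: (canRL (mulfK px0)).
    rewrite -pmE e1y e2y -y2 expr2 !mulNr mulrN; congr (- _).
    by rewrite [e1 * e2 * _]mulrC mulrACA.
  exact: integer_unit_mul.
have unit_e1 := integer_unit_factor Oe1 Oe2 unit_e12.
have unit_e2 : integer_unit e2.
  by apply: (integer_unit_factor Oe2 Oe1); rewrite mulrC.
have [e10 _ _] := unit_e1; have [e20 _ _] := unit_e2.
(* The numbers [2 + z] and [2 - z] have sum 4 and totally positive product [2 - x]. This serves for
   [z = y] and for [z = -y]. *)
have pos_pm z : (2%:R + z) * (2%:R - z) = 2%:R - x -> totally_positive (2%:R + z).
  move=> zE; split.
    by apply: contraNneq mx0 => z0; rewrite -zE z0 mul0r.
  move=> s real_s; apply: (sum_prod_gt0 (y := s (2%:R - z))) => //.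
  - rewrite -rmorphD addrACA subrr addr0 rmorphD rmorph_nat addr_gt0 //.
  - by rewrite -rmorphM zE; case: pos2 => _; apply.
exists y; split.
- by rewrite iterSr /square_sub2 y2 addrC addKr.
- rewrite e1y /y mulrAC mulfK ?expf_neq0 //; exact: integer_unit_mul.
- rewrite e1y e2y; have -> : - y * e2 / (y * e1) = -1 * (e2 / e1).
    by rewrite !mulNr mul1r -mulf_div divff // mul1r.
  by do 2?apply: integer_unit_mul => //; exact: integer_unit_inv.
- exact: pos_pm.
- by apply: pos_pm; rewrite opprK mulrC.
Qed.

(** The rescaled Chebyshev polynomial [2 T_m(X/2)] with [m = 2^k]. *)
Fixpoint sqr_sub2_poly (k : nat) : {poly rat} :=
  if k is j.+1 then sqr_sub2_poly j ^+ 2 - 2%:R%:P else 'X.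

Lemma sqr_sub2_polyP (k : nat) :
  sqr_sub2_poly k \is monic /\ size (sqr_sub2_poly k) = (2 ^ k).+1.
Proof.
elim: k => [|k [mon_p size_p]] /=; first by rewrite monicX size_polyX.
set p := sqr_sub2_poly k in mon_p size_p *.
have size_p2 : size (p ^+ 2) = (2 ^ k.+1).+1.
  by rewrite expr2 size_monicM ?monic_neq0 // size_p addnS succnK addSn addnn -mul2n -expnS.
have lt_size : (size (- 2%:R%:P : {poly rat})%R < size (p ^+ 2))%N.
  by rewrite size_polyN size_p2 ltnS (leq_trans (size_polyC_leq1 _)) // expn_gt0.
split; last by rewrite size_polyDl.
by rewrite monicE lead_coefDl // -monicE rpredX.
Qed.

Lemma horner_sqr_sub2_poly (A : fieldExtType rat) (k : nat) (x : A) :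
  (map_poly (in_alg A) (sqr_sub2_poly k)).[x] = iter k (@square_sub2 A) x.
Proof.
elim: k => [|k IHk] /=; first by rewrite map_polyX hornerX.
by rewrite rmorphB rmorphXn /= hornerD hornerN horner_exp IHk map_polyC hornerC /= scaler_nat.
Qed.

(** The cyclotomic polynomial is the minimal polynomial of a complex image of [z], so it divides
    that of [z], whose degree is [[L : Q]]. *)
Lemma totient_le_dim (L : fieldExtType rat) (N : nat) (z : L) :
  N.-primitive_root z -> <<1; z>>%VS = fullv -> (totient N <= \dim {:L})%N.
Proof.
move=> prim_z gen_z.
have [t [s _]] := number_field_embeddings L.
pose io := s (Ordinal (adim_gt0 {:L}%AS)).
have /polyOver1P[p minp] := minPolyOver 1 z.
have size_p : size p = (\dim {:L}).+1.
  have := size_minPoly 1 z; rewrite minp size_map_poly => ->.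
  by rewrite -gen_z dim_Fadjoin dimv1 muln1.
have prim_w : N.-primitive_root (io z) by rewrite fmorph_primitive_root.
have [q [defq _] dv_q] := minCpolyP (io z).
have : q %| p.
  rewrite -dv_q; have := root_minPoly 1 z; rewrite minp -(fmorph_root io).
  rewrite -map_poly_comp; congr (root _ _); apply: eq_map_poly => a /=.
  by rewrite alg_num_field fmorph_rat.
have p_neq0 : p != 0 by rewrite -size_poly_gt0 size_p.
move=> /(dvdp_leq p_neq0); rewrite -(size_map_poly (ratr : {rmorphism rat -> algC})) -defq.
by rewrite (minCpoly_cyclotomic prim_w) size_cyclotomic size_p.
Qed.

Lemma real_unity_root_sqr (x : algC) (N : nat) :
  (0 < N)%N -> x \is Num.real -> x ^+ N = 1 -> x ^+ 2 = 1.
Proof.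
move=> N_gt0 x_real xN.
have /eqP : `|x| ^+ N = 1 by rewrite -normrX xN normr1.
rewrite pexpr_eq1 // => /eqP x1.
by rewrite -real_normK // x1 expr1n.
Qed.

(** * The subfield generated by [z + z^-1] *)

Section RealCyclotomic.

Variables (L : fieldExtType rat) (n : nat) (z : L).
Hypothesis prim_z : (2 ^ (n + 2)).-primitive_root z.
Hypothesis gen_z : <<1; z>>%VS = fullv.

Let w := z + z^-1.
Let E : {subfield L} := <<1; w>>%AS.

Let z_neq0 : z != 0.
Proof.
apply/eqP => z0; have /eqP := prim_expr_order prim_z.
by rewrite z0 expr0n expn_eq0 /= eq_sym oner_eq0.
Qed.

(** The iterates are [z^(2^k) + z^-(2^k)]; the last one vanishes because [z^(2^(n+1)) = -1]. *)
Lemma iter_real_cyclotomic : iter n (@square_sub2 L) w = 0.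
Proof.
have iterE k : iter k (@square_sub2 L) w = z ^+ (2 ^ k) + z ^- (2 ^ k).
  elim: k => [|k IHk]; first by rewrite !expr1.
  rewrite iterS IHk /square_sub2 sqrrD divff ?expf_neq0 // expnSr exprM.
  by rewrite exprVn addrAC addrK.
have z2 : z ^+ (2 ^ n.+1) = -1.
  have /eqP : (z ^+ (2 ^ n.+1)) ^+ 2 = 1.
    by rewrite -exprM -expnSr -(addn2 n) (prim_expr_order prim_z).
  rewrite sqrf_eq1 => /orP[|/eqP //]; rewrite -(prim_order_dvd prim_z).
  by rewrite dvdn_Pexp2l // addn2 ltnn.
rewrite iterE; apply: (mulfI (expf_neq0 (2 ^ n) z_neq0)).
by rewrite mulrDr divff ?expf_neq0 // -expr2 -exprM -expnSr z2 addNr mulr0.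
Qed.

(** [z] is a root of [X^2 - w X + 1]. *)
Let size_minPoly_z : (size (minPoly E z) <= 3)%N.
Proof.
pose p : {poly L} := 'X^2 - w *: 'X + 1.
have size_r : (size (- (w *: 'X) + 1 : {poly L})%R < size ('X^2 : {poly L}))%N.
  rewrite size_polyXn ltnS (leq_trans (size_polyD _ _)) // geq_max size_polyN.
  by rewrite (leq_trans (size_scale_leq _ _)) ?size_polyX // size_poly1.
have size_p : size p = 3%N by rewrite /p -addrA size_polyDl // size_polyXn.
rewrite -size_p dvdp_leq //; first by rewrite -size_poly_gt0 size_p.
apply: minPoly_dvdp.
  rewrite rpredD ?rpred1 // rpredB ?polyOverXn // polyOverZ ?polyOverX //.
  exact: memv_adjoin.
by rewrite rootE !hornerE mulrDl mulVf // opprD addrA -expr2 subrr sub0r addNr.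
Qed.

Let gen_Ez : <<E; z>>%VS = fullv.
Proof.
apply/eqP; rewrite eqEsubv subvf -gen_z; apply: adjoinSl.
exact: sub1v.
Qed.

Lemma real_cyclotomic_coords (y : L) :
  exists a b : L, [/\ a \in E, b \in E & y = a + b * z].
Proof.
have y_in : y \in <<E; z>>%VS by rewrite gen_Ez memvf.
have size_y : (size (Fadjoin_poly E z y) <= 2)%N.
  by apply: leq_trans (size_Fadjoin_poly _ _ _) _; move: size_minPoly_z; rewrite size_minPoly.
have /polyOverP over_y := Fadjoin_polyOver E z y.
exists (Fadjoin_poly E z y)`_0, (Fadjoin_poly E z y)`_1; split; try exact: over_y.
rewrite -{1}(Fadjoin_poly_eq y_in) (horner_coef_wide _ size_y).
by rewrite big_ord_recl big_ord1 expr0 mulr1 expr1.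
Qed.

(** [[L : Q]] is at least [2^(n+1)], the totient of [2^(n+2)], and [[L : E]] is at most 2. *)
Lemma dim_real_cyclotomic : (2 ^ n <= \dim E)%N.
Proof.
have := totient_le_dim prim_z gen_z.
rewrite addn2 totient_pfactor //= mul1n -gen_Ez dim_Fadjoin expnS => le_dim.
rewrite -(leq_pmul2l (ltn0Sn 1)); apply: leq_trans le_dim _.
by rewrite leq_mul2r; move: size_minPoly_z; rewrite size_minPoly ltnS => ->; rewrite orbT.
Qed.

(** The minimal polynomial divides the right-hand side, which is monic of degree [2^n], and its own
    degree is at least [2^n]. *)
Lemma minPoly_real_cyclotomic :
  minPoly 1 w = map_poly (in_alg L) (sqr_sub2_poly n).
Proof.
have /polyOver1P[p minp] := minPolyOver 1 w.
have [mon_T size_T] := sqr_sub2_polyP n.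
have dvd_pT : p %| sqr_sub2_poly n.
  rewrite -(dvdp_map (in_alg L)) -minp; apply: minPoly_dvdp.
    exact: alg_polyOver.
  by rewrite rootE horner_sqr_sub2_poly iter_real_cyclotomic.
have mon_p : p \is monic by rewrite -(map_monic (in_alg L)) -minp monic_minPoly.
rewrite minp; congr (map_poly _ _); apply/eqP; rewrite -eqp_monic //.
rewrite -dvdp_size_eqp // eqn_leq dvdp_leq ?monic_neq0 //= size_T.
rewrite -(size_map_poly (in_alg L)) -minp size_minPoly ltnS.
by have := dim_real_cyclotomic; rewrite dim_Fadjoin dimv1 muln1.
Qed.

(** An element [a + b z] of [F] with [b] nonzero would make [z] real in an embedding, hence
    [z^2 = 1], against the order of [z]. *)
Lemma real_cyclotomic_maximal (F : {subfield L}) :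
  (1 <= n)%N -> totally_real (subvs_of E) -> totally_real (subvs_of F) -> (F <= E)%VS.
Proof.
move=> n_ge1 realE realF; apply/subvP => y Fy.
have [t [s _]] := number_field_embeddings L.
pose io := s (Ordinal (adim_gt0 {:L}%AS)).
have real_io (A : {subfield L}) : totally_real (subvs_of A) ->
    forall x, x \in A -> io x \is Num.real.
  move=> realA x Ax.
  have := realA (io \o vsval : {rmorphism subvs_of A -> algC}) (vsproj A x).
  by rewrite /= vsprojK.
have [a [b [Ea Eb def_y]]] := real_cyclotomic_coords y.
have [b0|b_neq0] := eqVneq b 0; first by rewrite def_y b0 mul0r addr0.
have zE : z = (y - a) / b by rewrite def_y addrC addKr mulrC mulKf.
have real_z : io z \is Num.real.
  rewrite zE rmorphM rmorphB fmorphV rpredM ?rpredB ?rpredV //;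
    by [exact: (real_io F) | exact: (real_io E)].
have : io z ^+ 2 = 1.
  apply: (real_unity_root_sqr _ real_z (N := 2 ^ (n + 2))).
    by rewrite expn_gt0.
  by rewrite -rmorphXn prim_expr_order // rmorph1.
move/eqP; rewrite -rmorphXn fmorph_eq1 -(prim_order_dvd prim_z).
by rewrite -[X in (_ %| X)%N]expn1 dvdn_Pexp2l // addn2 ltnS ltn0.
Qed.

(** The polynomial [sqr_sub2_poly n] kills [x] and is irreducible, being the minimal polynomial of
    [w]. So [x] generates [K] by degree, and sending [x] to [w] defines a morphism, onto because [w]
    generates [E]. *)
Lemma real_cyclotomic_iso (K : fieldExtType rat) (x : K) :
  \dim {:K} = (2 ^ n)%N -> iter n (@square_sub2 K) x = 0 ->
  field_isomorphic K (subvs_of E).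
Proof.
move=> dimK x_root.
have [mon_T size_T] := sqr_sub2_polyP n.
have /polyOver1P[p minp] := minPolyOver 1 x.
have mon_p : p \is monic by rewrite -(map_monic (in_alg K)) -minp monic_minPoly.
have dvd_pT : p %| sqr_sub2_poly n.
  rewrite -(dvdp_map (in_alg K)) -minp; apply: minPoly_dvdp.
    exact: alg_polyOver.
  by rewrite rootE horner_sqr_sub2_poly x_root.
have size_p : size p = (adjoin_degree 1 x).+1.
  by rewrite -(size_map_poly (in_alg K)) -minp size_minPoly.
have eq_pT : p = sqr_sub2_poly n.
  apply/eqP; rewrite -eqp_monic //.
  have := @minPoly_irr _ _ 1%AS w (map_poly (in_alg L) p) (alg_polyOver _ _).
  rewrite minPoly_real_cyclotomic dvdp_map => /(_ dvd_pT).
  rewrite eqp_map => /orP[// |]; rewrite -size_poly_eq1 size_map_poly size_p.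
  by rewrite eqSS /adjoin_degree.
have gen_x : <<1; x>>%VS = fullv.
  apply/eqP; rewrite eqEdim subvf dimK dim_Fadjoin dimv1 muln1 -ltnS -size_p.
  by rewrite eq_pT size_T ltnS leqnn.
have w_in : w \in E by exact: memv_adjoin.
pose wE : subvs_of E := vsproj E w.
have valE (q : {poly rat}) :
    vsval (map_poly (in_alg (subvs_of E)) q).[wE] = (map_poly (in_alg L) q).[w].
  rewrite -horner_map /= vsprojK // -map_poly_comp; congr _.[_].
  by apply: eq_map_poly => a /=; rewrite algid1.
have [|f fx] := @exists_rmorphism_root K (subvs_of E) (in_alg (subvs_of E)) x p wE gen_x minp.
  rewrite rootE -val_eqE /= valE eq_pT horner_sqr_sub2_poly.
  by rewrite iter_real_cyclotomic.
exists f; have /choice[g gK] (y : subvs_of E) : exists a, f a = y.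
  have /Fadjoin1_polyP[q def_q] := subvsP y.
  exists (map_poly (in_alg K) q).[x]; apply: val_inj; rewrite /= def_q -valE.
  congr vsval; rewrite -horner_map fx -map_poly_comp; congr _.[_].
  by apply: eq_map_poly => a /=; rewrite fmorph_numZ rmorph1.
by exists g => // a; apply: (fmorph_inj f); rewrite gK.
Qed.

End RealCyclotomic.

Theorem theorem13 (K : fieldExtType rat) (n : nat)
    (n_ge1 : (1 <= n)%N)
    (degK : \dim {: K} = (2 ^ n)%N)
    (realK : totally_real K)
    (ram2 : totally_ramified K 2)
    (odd_hK : odd (narrow_class_number K)) :
  exists2 E : {subfield cyclotomic_field (2 ^ (n + 2))%N},
    maximal_totally_real E & field_isomorphic K (subvs_of E).
Proof.
have N_gt0 : (0 < 2 ^ (n + 2))%N by rewrite expn_gt0.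
have [z prim_z gen_z] := cyclotomic_fieldP N_gt0.
have [x x_root] := sqrt_tower degK realK ram2 odd_hK.
have isoE := real_cyclotomic_iso prim_z gen_z degK x_root.
exists <<1; z + z^-1>>%AS => //.
(* Embeddings of this subfield pull back to embeddings of [K] along the isomorphism. *)
have realE : totally_real (subvs_of <<1; z + z^-1>>%AS).
  have [f [g fK gK]] := isoE.
  by move=> s y; have := realK (s \o f : {rmorphism K -> algC}) (g y); rewrite /= gK.
split=> // F; exact: (real_cyclotomic_maximal prim_z gen_z).
Qed.
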